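(* In the setting described in the context (finite lattice, call prices satisfying (C1)–(C4), payoff $a:\mathcal X\times\mathcal T\to[0,\infty)$), we have \[ \Phi^{\mathcal X,\mathcal T}(a,\mathbf C)=\mathcal P^{\mathcal X,\mathcal T}(a,\mathbf C)=\mathcal H^{\mathcal X,\mathcal T}(a,\mathbf C)=\Psi^{\mathcal X,\mathcal T}(a,\mathbf C). \] In particular, the supremum $\mathcal P^{\mathcal X,\mathcal T}(a,\mathbf C)$ of model-based prices over consistent models is attained by a price/regime model, i.e. there is $M\in\mathcal M_2^{\mathcal X,\mathcal T}(\mathbf C)$ with $\phi(M)=\mathcal P^{\mathcal X,\mathcal T}(a,\mathbf C)$; and there is a super-replicating Markovian semi-static strategy whose cost equals $\mathcal H^{\mathcal X,\mathcal T}(a,\mathbf C)$, i.e. is the lowest among all super-replicating semi-static strategies.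
   Context: Setting. Fix integers $N\ge 1$, $J\ge1$, times $0=t_0<t_1<\dots<t_N=T$, $\mathcal T=\{t_1,\dots,t_N\}$, an initial price $s_0>0$, strikes $0<x_1<\dots<x_J$, $x_0=0$ and $\mathcal X=\{x_0,x_1,\dots,x_J\}$. All prices are discounted (zero interest). A matrix $\mathbf C=(c_{j,n})_{0\le j\le J,1\le n\le N}$ of prices of calls paying $(X_{t_n}-x_j)^+$ at $t_n$ is given, with $c_{0,n}=s_0$, and satisfies: (C1) $s_0=c_{0,n}\ge c_{1,n}\ge\dots\ge c_{J,n}\ge0$ for all $n$; (C2) $1\ge\frac{c_{0,n}-c_{1,n}}{x_1}\ge\frac{c_{1,n}-c_{2,n}}{x_2-x_1}\ge\dots\ge\frac{c_{J-1,n}-c_{J,n}}{x_J-x_{J-1}}$ for all $n$; (C3) $c_{j,n+1}\ge c_{j,n}$ for $1\le n\le N-1$, $0\le j\le J$; (C4) $c_{J,N}=0$. Set $p_{0,n}=1-\frac{s_0-c_{1,n}}{x_1}$, $p_{j,n}=\frac{c_{j-1,n}-c_{j,n}}{x_j-x_{j-1}}-\frac{c_{j,n}-c_{j+1,n}}{x_{j+1}-x_j}$ for $1\le j<J$, $p_{J,n}=\frac{c_{J-1,n}-c_{J,n}}{x_J-x_{J-1}}$. The American payoff is a function $a:\mathcal X\times\mathcal T\to[0,\infty)$; exercise at $\tau\in\mathcal T$ pays $a(X_\tau,\tau)$. Models. $\mathcal M^{\mathcal X,\mathcal T}(\mathbf C)$ is the set of models: a probability space with filtration $(\mathcal F_{t_n})_{0\le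 n\le N}$ (not necessarily generated by $X$) and an adapted process $(X_{t_n})_{0\le n\le N}$ with $X_{t_0}=s_0$, $X_{t_n}\in\mathcal X$ for $n\ge1$, $X$ a martingale and $\mathbb P(X_{t_n}=x_j)=p_{j,n}$ for all $j,n$ (equivalently $\mathbb E[(X_{t_n}-x_j)^+]=c_{j,n}$). For a model $M$, $\phi(M)=\sup_\tau\mathbb E^M[a(X_\tau,\tau)]$, supremum over stopping times with values in $\mathcal T$; $\mathcal P^{\mathcal X,\mathcal T}(a,\mathbf C)=\sup_{M\in\mathcal M^{\mathcal X,\mathcal T}(\mathbf C)}\phi(M)$. $\mathcal M_2^{\mathcal X,\mathcal T}(\mathbf C)$ is the set of models in $\mathcal M^{\mathcal X,\mathcal T}(\mathbf C)$ whose filtration also supports an adapted process $\Delta$ with values in $\{1,2\}$, $\Delta_{t_0}=1$, such that: $\mathbb P(X_{t_{n+1}}=x_k\mid\mathcal F_{t_n})=\mathbb P(X_{t_{n+1}}=x_k\mid X_{t_n},\Delta_{t_n})$; $\Delta$ is non-decreasing with $\Delta_{t_N}=2$; and the conditional probability that $\Delta_{t_{n+1}}=2$ given $\Delta_{t_n}=1$ depends only on $n$ and $X_{t_{n+1}}$. Strategies. A semi-static strategy consists of reals $(b_{j,n})_{0\le j\le J,1\le n\le N}$ (a European claim paying $\sum_{n,j}b_{j,n}1_{\{X_{t_n}=x_j\}}$, with cost $H(\mathbf B)=\sum_{n,j}b_{j,n}p_{j,n}$) and functions $\Theta^1_{t_n}(x_{t_1},\dots,x_{t_n})$ and $\Theta^2_{t_n}(x_{t_1},\dots,x_{t_n},\rho)$,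 $1\le n\le N-1$ (stock holdings over $[t_n,t_{n+1}]$ before, resp. after, exercise at $\rho$; costless). Along a path $(x_{t_1},\dots,x_{t_N})$ with exercise at $\rho\in\mathcal T$, with $\mathcal N(\rho)=\min\{n:t_n\ge\rho\}$, the terminal payoff is $\mathcal G_T=\sum_{n,j}b_{j,n}1_{\{x_{t_n}=x_j\}}+\sum_{n=1}^{\mathcal N(\rho)-1}\Theta^1_{t_n}(x_{t_1},\dots,x_{t_n})(x_{t_{n+1}}-x_{t_n})+\sum_{n=\mathcal N(\rho)}^{N-1}\Theta^2_{t_n}(x_{t_1},\dots,x_{t_n},\rho)(x_{t_{n+1}}-x_{t_n})$. It super-replicates $a$ if $\mathcal G_T\ge a(x_\rho,\rho)$ for all paths in $\mathcal X^N$ and all $\rho\in\mathcal T$. $\mathcal H^{\mathcal X,\mathcal T}(a,\mathbf C)$ is the infimum of $H(\mathbf B)$ over super-replicating semi-static strategies. Given real arrays $e^1_{j,n},e^2_{j,n},v_{j,n}$ ($0\le j\le J$, $1\le n\le N$) and $d^1_{j,n},d^2_{j,n}$ ($1\le n\le N-1$), the associated Markovian semi-static strategy has $b_{j,n}=e^1_{j,n}+e^2_{j,n}$ for $n<N$, $b_{j,N}=e^1_{j,N}+e^2_{j,N}+v_{j,N}$, $\Theta^1_{t_n}=d^1_{j,n}$ and $\Theta^2_{t_n}=d^2_{j,n}$ whenever $x_{t_n}=x_j$. Primal LP $\mathbf L_P^{\mathcal X,\mathcal T}$: over $f_{j,n}\ge0$ ($0\le j\le J,1\le n\le N$) and $g^\delta_{j,k,n}\ge0$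 ($\delta\in\{1,2\}$, $0\le j,k\le J$, $1\le n\le N-1$), maximise $\sum_{n,j}a(x_j,t_n)f_{j,n}$ subject to: (a) $\sum_k(g^1_{j,k,n}+g^2_{j,k,n})=p_{j,n}$ for $1\le n\le N-1$; (b) $\sum_i(g^1_{i,j,n-1}+g^2_{i,j,n-1})=p_{j,n}$ for $2\le n\le N$; (c),(d) $\sum_k(x_k-x_j)g^\delta_{j,k,n}=0$ for $\delta=1,2$, $1\le n\le N-1$; (e) $f_{j,1}-\sum_kg^2_{j,k,1}\le0$, $f_{j,n}-\sum_kg^2_{j,k,n}+\sum_ig^2_{i,j,n-1}\le0$ for $1<n<N$, and $f_{j,N}+\sum_ig^2_{i,j,N-1}\le p_{j,N}$ (all for $0\le j\le J$). Its optimal value is $\Phi^{\mathcal X,\mathcal T}(a,\mathbf C)$. Dual LP $\mathbf L_H^{\mathcal X,\mathcal T}$: over reals $e^1_{j,n},e^2_{j,n},v_{j,n}$ ($0\le j\le J,1\le n\le N$) and $d^1_{j,n},d^2_{j,n}$ ($1\le n\le N-1$) with $e^1_{j,N}=e^2_{j,1}=0$, minimise $\sum_{j,n}(e^1_{j,n}+e^2_{j,n})p_{j,n}+\sum_jv_{j,N}p_{j,N}$ subject to $v_{j,n}\ge0$ and (i) $v_{j,n}\ge a(x_j,t_n)$; (ii) $e^1_{j,n}+e^2_{k,n+1}+(x_k-x_j)d^1_{j,n}\ge0$; (iii) $e^1_{j,n}+e^2_{k,n+1}+(x_k-x_j)d^2_{j,n}-v_{j,n}+v_{k,n+1}\ge0$,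 for all $0\le j,k\le J$, $1\le n\le N-1$. Its optimal value is $\Psi^{\mathcal X,\mathcal T}(a,\mathbf C)$. *)

(* Defs.v *)
From HB Require Import structures.
From mathcomp Require Import all_boot all_order all_algebra.
From mathcomp Require Import all_classical all_reals.
From mathcomp Require Import measure probability.

Set Implicit Arguments.
Unset Strict Implicit.
Unset Printing Implicit Defensive.

Import Order.TTheory GRing.Theory Num.Theory.
Local Open Scope classical_set_scope.
Local Open Scope ring_scope.

(* Conventions:
   - strikes x_0,...,x_J are given by x : nat -> R (only 0..J relevant);
   - times t_0,...,t_N by t : nat -> R (only 0..N relevant);
   - call prices c_{j,n} by c : nat -> nat -> R, c j n = c_{j,n};
   - the payoff a : R -> R -> R, a (x_j) (t_n) = a(x_j, t_n);
   - a random variable X_{t_n} with values in the lattice is represented by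
     the index of its value: X n w = j  means  X_{t_n}(w) = x_j. *)

Section Defs.
Context {R : realType}.

Definition slope (x : nat -> R) (c : nat -> nat -> R) (j n : nat) : R :=
  (c j.-1 n - c j n) / (x j - x j.-1).

Definition good_data (J N : nat) (t x : nat -> R) (s0 : R)
    (c : nat -> nat -> R) : Prop :=
  [/\ (1 <= J)%N, (1 <= N)%N, t 0%N = 0 & (forall n, (n < N)%N -> t n < t n.+1)] /\
  [/\ 0 < s0, x 0%N = 0 & (forall j, (j < J)%N -> x j < x j.+1)] /\
  [/\
      (forall n, (1 <= n <= N)%N -> c 0%N n = s0),
      (forall n, (1 <= n <= N)%N -> forall j, (j < J)%N -> c j.+1 n <= c j n)
      /\ (forall n, (1 <= n <= N)%N -> 0 <= c J n),
      (forall n, (1 <= n <= N)%N -> slope x c 1 n <= 1)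
      /\ (forall n, (1 <= n <= N)%N -> forall j, (1 <= j < J)%N ->
            slope x c j.+1 n <= slope x c j n),
      (forall n, (1 <= n < N)%N -> forall j, (j <= J)%N -> c j n <= c j n.+1) &
      c J N = 0].

Definition pr (J : nat) (x : nat -> R) (s0 : R) (c : nat -> nat -> R)
    (j n : nat) : R :=
  if j == 0%N then 1 - (s0 - c 1%N n) / x 1%N
  else if (j < J)%N then slope x c j n - slope x c j.+1 n
  else slope x c J n.

Section Model.
Context {d : measure_display} {T : measurableType d}.
Variable (P : probability T R).

Definition Pr (A : set T) : R := fine (P A).

Definition is_filtration (N : nat) (F : nat -> set (set T)) : Prop :=
  (forall n, (n <= N)%N -> sigma_algebra setT (F n)) /\
  (forall n, (n <= N)%N -> forall A, F n A -> measurable A) /\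
  (forall n m, (n <= m <= N)%N -> forall A, F n A -> F m A).

Definition ev (X : nat -> T -> nat) (n j : nat) : set T := [set w | X n w = j].

Definition is_model (J N : nat) (x : nat -> R) (s0 : R) (c : nat -> nat -> R)
    (F : nat -> set (set T)) (X : nat -> T -> nat) : Prop :=
  [/\ is_filtration N F,
      (forall n, (1 <= n <= N)%N -> forall w, (X n w <= J)%N),
      (forall n, (1 <= n <= N)%N -> forall j, F n (ev X n j)),
      (* martingale property (X_{t_0} = s0) :
         E[X_{t_{n+1}} 1_A] = E[X_{t_n} 1_A] for A in F_{t_n} *)
      (forall n, (n < N)%N -> forall A, F n A ->
         \sum_(k < J.+1) x k * Pr (A `&` ev X n.+1 k) =
         (if n == 0%N then s0 * Pr A
          else \sum_(k < J.+1) x k * Pr (A `&` ev X n k))) &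
      (forall n, (1 <= n <= N)%N -> forall j, (j <= J)%N ->
         Pr (ev X n j) = pr J x s0 c j n)].

Definition is_stopping_time (N : nat) (F : nat -> set (set T))
    (tau : T -> nat) : Prop :=
  (forall w, (1 <= tau w <= N)%N) /\
  (forall n, (1 <= n <= N)%N -> F n [set w | tau w = n]).

Definition exp_payoff (J N : nat) (t x : nat -> R) (a : R -> R -> R)
    (X : nat -> T -> nat) (tau : T -> nat) : R :=
  \sum_(1 <= n < N.+1) \sum_(j < J.+1)
     a (x j) (t n) * Pr ([set w | tau w = n] `&` ev X n j).

Definition model_price (J N : nat) (t x : nat -> R) (a : R -> R -> R)
    (F : nat -> set (set T)) (X : nat -> T -> nat) : R :=
  sup [set exp_payoff J N t x a X tau | tau in is_stopping_time N F].

Definition is_model2 (J N : nat) (x : nat -> R) (s0 : R) (c : nat -> nat -> R)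
    (F : nat -> set (set T)) (X : nat -> T -> nat) (D : nat -> T -> nat) : Prop :=
  [/\ is_model J N x s0 c F X,
      (forall n, (n <= N)%N -> forall w, D n w = 1%N \/ D n w = 2%N)
      /\ (forall n, (n <= N)%N -> forall i, F n (ev D n i)),
      [/\ forall w, D 0%N w = 1%N,
          forall n w, (n < N)%N -> (D n w <= D n.+1 w)%N &
          forall w, D N w = 2%N],
      (* P(X_{t_{n+1}} = x_k | F_{t_n}) = P(X_{t_{n+1}} = x_k | X_{t_n}, Delta_{t_n}) *)
      (forall A k, F 0%N A ->
          Pr (A `&` ev X 1 k) = Pr A * Pr (ev X 1 k))
      /\ (forall n, (1 <= n < N)%N -> forall A j i k, F n A ->
          let B := ev X n j `&` ev D n i in
          Pr (A `&` B `&` ev X n.+1 k) * Pr B =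
          Pr (A `&` B) * Pr (B `&` ev X n.+1 k)) &
      (* P(Delta_{t_{n+1}} = 2 | F_{t_n}, X_{t_{n+1}}) on {Delta_{t_n} = 1}
         is a function h_n(X_{t_{n+1}}) *)
      (forall n, (n < N)%N -> exists h : nat -> R,
          forall A k, F n A ->
            Pr (A `&` ev D n 1 `&` ev X n.+1 k `&` ev D n.+1 2) =
            h k * Pr (A `&` ev D n 1 `&` ev X n.+1 k))].

End Model.

Definition model_sup (J N : nat) (t x : nat -> R) (s0 : R)
    (c : nat -> nat -> R) (a : R -> R -> R) : R :=
  sup [set r | exists (d : measure_display) (T : measurableType d)
                 (P : probability T R) (F : nat -> set (set T))
                 (X : nat -> T -> nat),
          is_model P J N x s0 c F X /\ r = model_price P J N t x a F X].

(* paths are represented by the sequence of indices: path n = j means x_{t_n} = x_j *)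
Definition nonanticipative (N : nat) (Th1 : nat -> (nat -> nat) -> R)
    (Th2 : nat -> (nat -> nat) -> nat -> R) : Prop :=
  forall n, (1 <= n < N)%N -> forall p q : nat -> nat,
    (forall m, (1 <= m <= n)%N -> p m = q m) ->
    Th1 n p = Th1 n q /\ forall r, Th2 n p r = Th2 n q r.

(* G_T along path with exercise at rho = t_r *)
Definition gain (J N : nat) (x : nat -> R) (b : nat -> nat -> R)
    (Th1 : nat -> (nat -> nat) -> R) (Th2 : nat -> (nat -> nat) -> nat -> R)
    (path : nat -> nat) (r : nat) : R :=
  \sum_(1 <= n < N.+1) \sum_(j < J.+1) b j n * (path n == j)%:R
  + \sum_(1 <= n < r) Th1 n path * (x (path n.+1) - x (path n))
  + \sum_(r <= n < N) Th2 n path r * (x (path n.+1) - x (path n)).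

Definition superreplicates (J N : nat) (t x : nat -> R) (a : R -> R -> R)
    (b : nat -> nat -> R) (Th1 : nat -> (nat -> nat) -> R)
    (Th2 : nat -> (nat -> nat) -> nat -> R) : Prop :=
  forall path : nat -> nat, (forall n, (1 <= n <= N)%N -> (path n <= J)%N) ->
  forall r, (1 <= r <= N)%N ->
    a (x (path r)) (t r) <= gain J N x b Th1 Th2 path r.

Definition cost (J N : nat) (x : nat -> R) (s0 : R) (c : nat -> nat -> R)
    (b : nat -> nat -> R) : R :=
  \sum_(1 <= n < N.+1) \sum_(j < J.+1) b j n * pr J x s0 c j n.

Definition hedge_inf (J N : nat) (t x : nat -> R) (s0 : R)
    (c : nat -> nat -> R) (a : R -> R -> R) : R :=
  inf [set cost J N x s0 c b | b in
        [set b | exists Th1 Th2, nonanticipative N Th1 Th2 /\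
                   superreplicates J N t x a b Th1 Th2]].

Definition markov_b (N : nat) (e1 e2 v : nat -> nat -> R) : nat -> nat -> R :=
  fun j n => if n == N then e1 j n + e2 j n + v j n else e1 j n + e2 j n.
Definition markov_Th1 (d1 : nat -> nat -> R) : nat -> (nat -> nat) -> R :=
  fun n path => d1 (path n) n.
Definition markov_Th2 (d2 : nat -> nat -> R) : nat -> (nat -> nat) -> nat -> R :=
  fun n path _ => d2 (path n) n.

Definition primal_feasible (J N : nat) (x : nat -> R) (s0 : R)
    (c : nat -> nat -> R) (f : nat -> nat -> R)
    (g : bool -> nat -> nat -> nat -> R) : Prop :=
  (* g true = g^1, g false = g^2 *)
  let p := pr J x s0 c in
  [/\ (forall j n, (j <= J)%N -> (1 <= n <= N)%N -> 0 <= f j n) /\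
      (forall dl j k n, (j <= J)%N -> (k <= J)%N -> (1 <= n < N)%N ->
         0 <= g dl j k n),
      (forall j n, (j <= J)%N -> (1 <= n < N)%N ->
         \sum_(k < J.+1) (g true j k n + g false j k n) = p j n),
      (forall j n, (j <= J)%N -> (2 <= n <= N)%N ->
         \sum_(i < J.+1) (g true i j n.-1 + g false i j n.-1) = p j n),
      (forall dl j n, (j <= J)%N -> (1 <= n < N)%N ->
         \sum_(k < J.+1) (x k - x j) * g dl j k n = 0) &
      (forall j, (j <= J)%N ->
         [/\ (1 < N)%N -> f j 1%N - \sum_(k < J.+1) g false j k 1%N <= 0,
             (forall n, (1 < n < N)%N ->
                f j n - \sum_(k < J.+1) g false j k n
                      + \sum_(i < J.+1) g false i j n.-1 <= 0) &
             f j N + (if (1 < N)%N then \sum_(i < J.+1) g false i j N.-1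
                      else 0) <= p j N])].

Definition primal_obj (J N : nat) (t x : nat -> R) (a : R -> R -> R)
    (f : nat -> nat -> R) : R :=
  \sum_(1 <= n < N.+1) \sum_(j < J.+1) a (x j) (t n) * f j n.

Definition primal_value (J N : nat) (t x : nat -> R) (s0 : R)
    (c : nat -> nat -> R) (a : R -> R -> R) : R :=
  sup [set primal_obj J N t x a f | f in
        [set f | exists g, primal_feasible J N x s0 c f g]].

Definition dual_feasible (J N : nat) (t x : nat -> R) (a : R -> R -> R)
    (e1 e2 v d1 d2 : nat -> nat -> R) : Prop :=
  [/\ (forall j, (j <= J)%N -> e1 j N = 0 /\ e2 j 1%N = 0),
      (forall j n, (j <= J)%N -> (1 <= n <= N)%N -> 0 <= v j n),
      (forall j n, (j <= J)%N -> (1 <= n <= N)%N -> a (x j) (t n) <= v j n),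
      (forall j k n, (j <= J)%N -> (k <= J)%N -> (1 <= n < N)%N ->
         0 <= e1 j n + e2 k n.+1 + (x k - x j) * d1 j n) &
      (forall j k n, (j <= J)%N -> (k <= J)%N -> (1 <= n < N)%N ->
         0 <= e1 j n + e2 k n.+1 + (x k - x j) * d2 j n - v j n + v k n.+1)].

Definition dual_obj (J N : nat) (x : nat -> R) (s0 : R) (c : nat -> nat -> R)
    (e1 e2 v : nat -> nat -> R) : R :=
  \sum_(j < J.+1) \sum_(1 <= n < N.+1) (e1 j n + e2 j n) * pr J x s0 c j n
  + \sum_(j < J.+1) v j N * pr J x s0 c j N.

Definition dual_value (J N : nat) (t x : nat -> R) (s0 : R)
    (c : nat -> nat -> R) (a : R -> R -> R) : R :=
  inf [set r | exists e1 e2 v d1 d2, dual_feasible J N t x a e1 e2 v d1 d2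
                 /\ r = dual_obj J N x s0 c e1 e2 v].

End Defs.

(* Main.v *)
Require Import Defs.
From HB Require Import structures.
From mathcomp Require Import all_boot all_order all_algebra.
From mathcomp Require Import all_classical all_reals.
From mathcomp Require Import interval_inference measure probability.
From mathcomp Require Import ring lra zify.
Import Order.TTheory GRing.Theory Num.Theory.
Local Open Scope classical_set_scope.
Local Open Scope ring_scope.

(* Weak duality gives Phi <= P <= H <= Psi: a primal solution (f, g) is turned into
   a price/regime model by running a Markov chain with kernels proportional to g^1
   and g^2 and exercising at the regime switch; in any model a super-replicating
   portfolio costs at least the expected exercise payoff, because every trade has
   mean zero; and a dual solution is the cost of a super-replicating Markovian
   strategy, by telescoping v along the path after exercise. Linear programming
   duality, with attainment on both sides, gives Phi = Psi and closes the chain.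
   Primal feasibility is Strassen's theorem on the lattice: a Farkas certificate
   against a martingale coupling of consecutive marginals would yield a convex
   function violating (C3). *)

(** * Linear programming duality *)

(** The linear program that gets solved is the dual one: sign-free variables, finitely many
    inequalities. The primal variables are recovered as its multipliers: [f] for (i), g^1 for (ii),
    g^2 for (iii), while the multiplier of v >= 0 is the slack in (e). Attainment on both sides
    comes from Farkas alternatives alone, without compactness. The models in the supremum have
    arbitrary probability spaces and filtrations. For weak duality each is projected onto the finite
    set of index paths with exercise flags; the truncation of such a path at t_n is known in
    F_{t_n}, and the martingale property is used only on the events that fix this truncation. In the
    converse direction the switching probability may depend only on the node of arrival. By (e),
    f_{j,n} is at most the increase of the regime 2 flow through the node (j,n); dividing this
    increase by the mass arriving in regime 1 gives the probability, and (a), (b) keep it at most 1.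
    At t_N the switch is forced, so mass that never switched is exercised there. *)

Definition linear_form {R : realFieldType} {W : lmodType R} (f : W -> R) :=
  forall a u v, f (a *: u + v) = a * f u + f v.

Lemma sum_option {R : nmodType} (C : finType) (F : option C -> R) :
  \sum_i F i = F None + \sum_i F (Some i).
Proof.
rewrite (bigD1 None) //=; congr (_ + _).
by rewrite (reindex_omap Some id) //=; [apply: eq_bigl => i; rewrite eqxx|case].
Qed.

Section LinearForm.
Context {R : realFieldType} {W : lmodType R}.

Lemma linear_form0 {f : W -> R} : linear_form f -> f 0 = 0.
Proof.
move=> lf; have := lf 1 0 0; rewrite scaler0 addr0 mul1r => /eqP.
by rewrite -subr_eq0 opprD addNKr oppr_eq0 => /eqP.
Qed.

Lemma linear_formZ {f : W -> R} a u : linear_form f -> f (a *: u) = a * f u.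
Proof. by move=> lf; rewrite -[a *: u]addr0 lf linear_form0 // addr0. Qed.

(** Homogenisation: the extra coordinate stands for the constant 1, so that the affine inequality
    [b <= f w] becomes a linear one. *)
Lemma linear_formB {f : W -> R} b : linear_form f ->
  linear_form (fun w : W * R^o => f w.1 - b * (w.2 : R)).
Proof. by move=> lf a [u r] [v s] /=; rewrite lf /GRing.scale /=; ring. Qed.

(* Bartl's algebraic proof, by induction on the number of forms: if a solution x
   for the tail violates the head form, the other forms are projected along x
   onto the kernel of the head form. *)
Lemma farkas_seq {C : eqType} {r : seq C} : uniq r ->
  forall (al : C -> W -> R) (ga : W -> R),
  (forall i, linear_form (al i)) -> linear_form ga ->
  (exists2 l : C -> R, forall i, 0 <= l i &
     forall w, ga w = \sum_(i <- r) l i * al i w) \/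
  (exists2 w, {in r, forall i, al i w <= 0} & 0 < ga w).
Proof.
elim: r => [_ al ga lal lga|c r IH /= /andP[cr ur] al ga lal lga].
  have [h|] := pselect (forall w, ga w = 0).
    by left; exists (fun=> 0) => // w; rewrite big_nil.
  move=> /existsNP[w /eqP gw]; right; exists (ga w *: w) => //.
  by rewrite linear_formZ // -expr2 exprn_even_gt0.
have cons_l (l : C -> R) (m : R) w :
    \sum_(i <- c :: r) (if i == c then m else l i) * al i w =
    m * al c w + \sum_(i <- r) l i * al i w.
  rewrite big_cons eqxx; congr (_ + _); apply: eq_big_seq => i ir.
  by case: eqP => // ic; rewrite -ic ir in cr.
have [[l l0 lE]|[w wr gw]] := IH ur al ga lal lga.
  left; exists (fun i => if i == c then 0 else l i).
    by move=> i; case: ifP.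
  by move=> w; rewrite cons_l mul0r add0r.
have [cw|cw] := leP (al c w) 0.
  by right; exists w => // i; rewrite inE => /predU1P[->//|/wr].
pose x := (al c w)^-1 *: w.
have cx : al c x = 1 by rewrite linear_formZ // mulVf // gt_eqF.
have gx : 0 < ga x by rewrite linear_formZ // mulr_gt0 // invr_gt0.
have rx i : i \in r -> al i x <= 0.
  by move=> ir; rewrite linear_formZ // mulr_ge0_le0 ?invr_ge0 ?wr // ltW.
have [||[l l0 lE]|[w' wr' gw']] := IH ur
    (fun i u => al i u - al i x * al c u) (fun u => ga u - ga x * al c u).
- by move=> i a u v; rewrite !lal; ring.
- by move=> a u v; rewrite lga lal; ring.
(* Undoing the projection leaves this coefficient on the head form; it is nonnegative because
   [ga x > 0] and every [al i x <= 0]. *)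
- left; exists (fun i => if i == c then ga x - \sum_(i <- r) l i * al i x
                         else l i).
    move=> i; case: ifP => // _; rewrite subr_ge0 (le_trans _ (ltW gx)) //.
    rewrite big_seq; apply: sumr_le0 => j jr.
    by rewrite mulr_ge0_le0 // rx.
  move=> u; rewrite cons_l.
  have /eqP := lE u; rewrite subr_eq => /eqP ->.
  rewrite mulrBl mulr_suml.
  under eq_bigr do rewrite mulrBr mulrA.
  by rewrite sumrB; ring.
- right; exists (- al c w' *: x + w') => [i|].
    rewrite inE => /predU1P[->|ir]; first by rewrite lal cx; lra.
    by have := wr' i ir; rewrite lal; lra.
  by move: gw'; rewrite lga; lra.
Qed.

Lemma farkas {C : finType} (al : C -> W -> R) (ga : W -> R) :
  (forall i, linear_form (al i)) -> linear_form ga ->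
  (exists2 l : C -> R, forall i, 0 <= l i &
     forall w, ga w = \sum_i l i * al i w) \/
  (exists2 w, forall i, al i w <= 0 & 0 < ga w).
Proof.
move=> lal lga.
have [|[w wr gw]] := farkas_seq (index_enum_uniq C) al ga lal lga; first by left.
by right; exists w => // i; rewrite wr // mem_index_enum.
Qed.

End LinearForm.

(** Farkas for the homogenised forms with the extra coordinate as target: a point where it is
    positive rescales to a solution, and otherwise the certificate is read off at [(w, 0)] and
    [(0, 1)]. *)
Lemma farkas_affine {R : realFieldType} {W : lmodType R} {C : finType}
    (al : C -> W -> R) (be : C -> R) :
  (forall i, linear_form (al i)) ->
  (exists w, forall i, be i <= al i w) \/
  (exists l : C -> R, [/\ forall i, 0 <= l i,
     forall w, \sum_i l i * al i w = 0 & 0 < \sum_i l i * be i]).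
Proof.
move=> lal.
have lo : linear_form (fun w : W * R^o => (w.2 : R)).
  by move=> a [u r] [v s].
have [|//||] := @farkas R (W * R^o)%type C
    (fun i w => - (al i w.1 - be i * w.2)) (fun w => w.2).
- by move=> i a u v; rewrite (linear_formB _ (lal i)); ring.
- move=> [l l0 lE]; right; exists l; split => //.
    move=> w; have /= := lE (w, 0); move=> /esym.
    under eq_bigr do rewrite mulr0 subr0 mulrN.
    by rewrite sumrN => /eqP; rewrite oppr_eq0 => /eqP.
  have /= := lE (0, 1).
  under eq_bigr do rewrite linear_form0 // sub0r opprK mulr1.
  by move=> <-.
- move=> [[w s] /= ws s0]; left; exists (s^-1 *: w) => i.
  rewrite linear_formZ // ler_pdivlMl // mulrC.
  by have := ws i; lra.
Qed.

Section LPDuality.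
Context {R : realType} {W : lmodType R} {C : finType}.
Variables (al : C -> W -> R) (be : C -> R) (ga : W -> R).
Hypotheses (lal : forall i, linear_form (al i)) (lga : linear_form ga).

Definition lp_feasible w := forall i, be i <= al i w.
(** Feasible points of the program dual to minimising [ga]; as [w] is free in sign, the combination
    has to equal [ga]. *)
Definition lp_multiplier (l : C -> R) :=
  (forall i, 0 <= l i) /\ forall w, ga w = \sum_i l i * al i w.

Lemma lp_weak_duality w l :
  lp_feasible w -> lp_multiplier l -> \sum_i l i * be i <= ga w.
Proof. by move=> fw [l0 ->]; apply: ler_sum => i _; rewrite ler_wpM2l. Qed.

(** Both optima are reached at [m], the supremum of the multiplier values. One alternative yields a
    feasible [w] with [ga w <= m], another a multiplier of value at least [m]; [w0] and [l0] exclude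
    the degenerate certificates. *)
Lemma lp_strong_duality w0 l0 : lp_feasible w0 -> lp_multiplier l0 ->
  exists w l, [/\ lp_feasible w, lp_multiplier l & ga w = \sum_i l i * be i].
Proof.
move=> fw0 ml0.
pose S := [set \sum_i l i * be i | l in lp_multiplier].
have ubS w : lp_feasible w -> ubound S (ga w).
  by move=> fw _ [l ml <-]; exact: lp_weak_duality.
have S0 : S !=set0 by exists (\sum_i l0 i * be i), l0.
have supS : has_sup S by split => //; exists (ga w0); exact: ubS.
pose m := sup S.
have leS l : lp_multiplier l -> \sum_i l i * be i <= m.
  by move=> ml; apply: sup_upper_bound => //; exists l.
have geS w : lp_feasible w -> m <= ga w.
  by move=> fw; apply: ge_sup => //; exact: ubS.
have [w fw wm] : exists2 w, lp_feasible w & ga w <= m.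
  have [|[w fw]|[l [lge lE lb]]] := farkas_affine (C := option C)
    (fun o w => if o is Some i then al i w else - ga w)
    (fun o => if o is Some i then be i else - m).
  - case=> [i|] a u v /=; first exact: lal.
    by rewrite lga; ring.
  - exists w => [i|]; first exact: (fw (Some i)).
    by have := fw None; rewrite lerN2.
  - exfalso.
    pose k := l None; pose l' i := l (Some i).
    have lE' w : \sum_i l' i * al i w = k * ga w.
      have := lE w; rewrite sum_option /=.
      by rewrite /l' /k; lra.
    have lb' : k * m < \sum_i l' i * be i.
      by move: lb; rewrite sum_option /= /l' /k; lra.
    have l'0 i : 0 <= l' i by exact: lge.
    (* With [k = 0] the certificate would refute the feasibility of [w0]; with [k > 0] it scales to
       a multiplier of value above [m]. *)
    have [k0|k0] := eqVneq k 0.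
      have : \sum_i l' i * be i <= \sum_i l' i * al i w0.
        by apply: ler_sum => i _; rewrite ler_wpM2l.
      by rewrite lE'; move: lb'; rewrite k0; lra.
    have kgt0 : 0 < k by rewrite lt_neqAle eq_sym k0 lge.
    have /leS : lp_multiplier (fun i => k^-1 * l' i).
      split=> [i|w]; first by rewrite mulr_ge0 // invr_ge0 ltW.
      under eq_bigr do rewrite -mulrA.
      by rewrite -mulr_sumr lE' mulKf.
    under eq_bigr do rewrite -mulrA.
    by rewrite -mulr_sumr ler_pdivrMl // leNgt lb'.
have [l ml lm] : exists2 l, lp_multiplier l & m <= \sum_i l i * be i.
  have [||[l lge lE]|[[v s] vs gv]] := @farkas R (W * R^o)%type (option C)
    (fun o w => if o is Some i then al i w.1 - be i * w.2 else w.2)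
    (fun w => ga w.1 - m * w.2).
  - by case=> [i|]; [exact: linear_formB|move=> a [u r] [v s]].
  - exact: linear_formB.
  - exists (fun i => l (Some i)).
      split=> [i|u]; first exact: lge.
      have := lE (u, 0); rewrite sum_option /= mulr0 subr0 mulr0 add0r => ->.
      by apply: eq_bigr => i _; rewrite mulr0 subr0.
    have := lE (0, 1); rewrite sum_option /= linear_form0 // sub0r !mulr1.
    under eq_bigr do rewrite linear_form0 // mulr1 sub0r mulrN.
    by rewrite sumrN; have := lge None; lra.
  - exfalso.
    have s0 : s <= 0 := vs None.
    have /= vs' i := vs (Some i).
    move: gv => /= gv.
    (* With [s = 0], writing [ga] through [l0] contradicts [ga v > 0]; with [s < 0] the point scales
       to a feasible one of value below [m]. *)
    have [s_eq0|sn0] := eqVneq s 0.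
      move: gv; rewrite s_eq0 mulr0 subr0 ml0.2; apply/negP; rewrite -leNgt.
      apply: sumr_le0 => i _; rewrite mulr_ge0_le0 //; first exact: ml0.1.
      by have := vs' i; rewrite s_eq0 mulr0 subr0.
    have slt0 : s < 0 by rewrite lt_neqAle sn0.
    have /geS : lp_feasible (s^-1 *: v).
      by move=> i; rewrite linear_formZ // ler_ndivlMl //; have := vs' i; lra.
    by rewrite linear_formZ // ler_ndivlMl //; lra.
exists w, l; split => //; apply/le_anti.
by rewrite (le_trans wm lm) lp_weak_duality.
Qed.

End LPDuality.

(** * Consistent call prices *)

Lemma sum_by_parts {R : comRingType} (h s : nat -> R) m :
  \sum_(j < m.+1) h j * (s j - s j.+1) =
  h 0%N * s 0%N - h m * s m.+1 + \sum_(j < m) (h j.+1 - h j) * s j.+1.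
Proof.
elim: m => [|m IH]; first by rewrite big_ord_recr !big_ord0 /=; ring.
by rewrite big_ord_recr IH [in RHS]big_ord_recr /=; ring.
Qed.

Lemma sum_ord_delta {R : pzRingType} m (F : nat -> R) j : (j <= m)%N ->
  \sum_(i < m.+1) F i * (i == j :> nat)%:R = F j.
Proof.
move=> jm; rewrite (bigD1 (inord j)) //= inordK // eqxx mulr1 big1 ?addr0 // => i.
by rewrite -val_eqE /= inordK // => /negPf ->; rewrite mulr0.
Qed.

Lemma scale_addE {R : pzRingType} (a : R) (u v : nat -> nat -> R^o) i j :
  (a *: u + v) i j = a * u i j + v i j.
Proof. by []. Qed.

Section Prices.
Context {R : realType} {J N : nat} {t x : nat -> R} {s0 : R}.
Context {c : nat -> nat -> R}.
Hypothesis gd : good_data J N t x s0 c.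
Local Notation p := (pr J x s0 c).

Lemma strike_lt j : (j < J)%N -> x j < x j.+1.
Proof. by case: gd => _ [[_ _ xlt] _] jJ; exact: xlt. Qed.

(** The price of the last call increases with maturity by (C3) and ends at 0 by (C4). *)
Lemma last_call_eq0 n : (1 <= n <= N)%N -> c J n = 0.
Proof.
case: gd => _ [_ [_ [_ c0] _ cmon cJN]] nN.
apply/le_anti; rewrite c0 // andbT.
have : forall k, (n <= k <= N)%N -> c J n <= c J k.
  elim=> [|k IH] nk; first by case: n nN nk {c0}.
  move: nk; rewrite leq_eqVlt; case: eqP => [<- //|_ /= nk].
  by apply: (le_trans (IH _)); [lia|apply: cmon; lia].
by move=> /(_ N); rewrite cJN; apply; lia.
Qed.

(** With slope 1 before the first strike and 0 after the last, every [p j n] is a difference of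
    consecutive slopes, and summation by parts applies. *)
Lemma sum_pr (h : nat -> R) n : (1 <= n <= N)%N ->
  \sum_(j < J.+1) h j * p j n =
  h 0%N + \sum_(j < J) (h j.+1 - h j) * slope x c j.+1 n.
Proof.
move=> nN; case: gd => -[J1 _ _ _] [[_ x0 _] [c0 _ _ _ _]].
pose s j := if j == 0%N then 1 else if (j <= J)%N then slope x c j n else 0.
have pE j : (j <= J)%N -> p j n = s j - s j.+1.
  rewrite /pr /s; case: j => [|j] /= jJ; first by rewrite J1 /slope /= c0 // x0 subr0.
  rewrite jJ; have [//|Jj|->] := ltngtP j.+1 J; last by rewrite subr0.
  by rewrite ltnNge jJ in Jj.
rewrite (eq_bigr (fun j : 'I_J.+1 => h j * (s j - s j.+1))); last first.
  by move=> j _; rewrite pE // -ltnS.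
rewrite sum_by_parts /s /= ltnn mulr0 subr0 mulr1; congr (_ + _).
by apply: eq_bigr => j _; rewrite ltn_ord.
Qed.

Lemma sum_pr1 n : (1 <= n <= N)%N -> \sum_(j < J.+1) p j n = 1.
Proof.
move=> nN; have := sum_pr (fun=> 1) n nN.
under eq_bigr do rewrite mul1r.
by move=> ->; rewrite big1 ?addr0 // => j _; rewrite subrr mul0r.
Qed.

Lemma mean_pr n : (1 <= n <= N)%N -> \sum_(j < J.+1) x j * p j n = s0.
Proof.
move=> nN; rewrite sum_pr //; case: gd => _ [[_ x0 _] [c0 _ _ _ _]].
rewrite (eq_bigr (fun j : 'I_J => - (c j.+1 n - c j n))); last first.
  move=> j _; rewrite /slope /= mulrC mulfVK; first by rewrite opprB.
  by rewrite subr_eq0 gt_eqF // strike_lt.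
rewrite sumrN -(big_mkord xpredT (fun j => c j.+1 n - c j n)) telescope_sumr //.
by rewrite x0 last_call_eq0 // c0 // add0r sub0r opprK.
Qed.

Lemma pr_ge0 j n : (j <= J)%N -> (1 <= n <= N)%N -> 0 <= p j n.
Proof.
move=> jJ nN; case: gd => -[J1 _ _ _] [[_ x0 xlt] [c0 [cd _] [s1 sd] _ _]].
rewrite /pr; case: eqP => [_|/eqP j0].
  by have := s1 n nN; rewrite /slope /= c0 // x0 subr0 subr_ge0.
case: ifP => jJ'; first by rewrite subr_ge0 sd // lt0n j0.
case: J J1 cd xlt => // J' _ cd xlt.
by rewrite /slope divr_ge0 //= subr_ge0 ?cd ?ltW ?xlt.
Qed.

(** A second summation by parts pairs the slope increments of [u], nonnegative by convexity, with
    [c j n.+1 - c j n], nonnegative by (C3). The boundary terms vanish since these price differences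
    are 0 at the first and last strikes. *)
Lemma convex_order (u : nat -> R) n : (1 <= n < N)%N ->
  (forall j, (j.+1 < J)%N ->
    (u j.+1 - u j) / (x j.+1 - x j) <= (u j.+2 - u j.+1) / (x j.+2 - x j.+1)) ->
  \sum_(j < J.+1) u j * p j n <= \sum_(j < J.+1) u j * p j n.+1.
Proof.
move=> nN ucvx; case: gd => -[J1 _ _ _] [[_ x0 xlt] [c0 _ _ cm _]].
rewrite !sum_pr; try lia.
rewrite lerD2l -subr_ge0 -sumrB.
pose m j := (u j.+1 - u j) / (x j.+1 - x j).
pose D j := c j n.+1 - c j n.
rewrite (eq_bigr (fun j : 'I_J => m j * (D j - D j.+1))); last first.
  move=> j _; rewrite /slope /m /D /=; field.
  by rewrite subr_eq0 gt_eqF // strike_lt.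
have DJ : D J = 0 by rewrite /D !last_call_eq0 ?subrr //; lia.
have D0 : D 0%N = 0 by rewrite /D !c0 ?subrr //; lia.
have D_ge0 j : (j <= J)%N -> 0 <= D j by move=> jJ; rewrite subr_ge0 cm.
case: J J1 DJ ucvx D_ge0 => // J' _ DJ ucvx D_ge0.
rewrite sum_by_parts DJ D0 !mulr0 subr0 add0r; apply: sumr_ge0 => j _.
have := ltn_ord j => jJ.
by rewrite mulr_ge0 ?D_ge0 ?subr_ge0 /m ?ucvx //; lia.
Qed.

(** Value at [x k] of the upper envelope of the lines through the points [(x j, al j)] with slopes
    [d j]. *)
Definition max_line (al d : nat -> R) (k : nat) : R :=
  let F (j : 'I_J.+1) := al j + (x k - x j) * d j in
  F [arg max_(j > ord0) F j]%O.

Lemma le_max_line al d k j : (j <= J)%N ->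
  al j + (x k - x j) * d j <= max_line al d k.
Proof.
move=> jJ; rewrite /max_line; case: arg_maxP => // i _ /(_ (inord j) isT).
by rewrite inordK.
Qed.

Lemma max_line_attained al d k :
  exists2 j, (j <= J)%N & max_line al d k = al j + (x k - x j) * d j.
Proof. by rewrite /max_line; case: arg_maxP => // i _ _; exists i; rewrite // -ltnS. Qed.

(** The slope of a line active at the middle strike separates the two difference quotients. *)
Lemma max_line_convex al d j : (j.+1 < J)%N ->
  (max_line al d j.+1 - max_line al d j) / (x j.+1 - x j) <=
  (max_line al d j.+2 - max_line al d j.+1) / (x j.+2 - x j.+1).
Proof.
move=> jJ; have [i iJ ->] := max_line_attained al d j.+1.
have := le_max_line al d j _ iJ; have := le_max_line al d j.+2 _ iJ.
have x1 : 0 < x j.+1 - x j by rewrite subr_gt0 strike_lt // ltnW.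
have x2 : 0 < x j.+2 - x j.+1 by rewrite subr_gt0 strike_lt.
move=> h2 h0; apply: (@le_trans _ _ (d i)).
  by rewrite ler_pdivrMr //; lra.
by rewrite ler_pdivlMr //; lra.
Qed.

(* A Farkas certificate against a martingale coupling would be a family of lines
   whose maximum is a convex function violating the convex order. *)
Lemma martingale_coupling n : (1 <= n < N)%N ->
  exists g : nat -> nat -> R,
  [/\ forall j k, 0 <= g j k,
      forall j, (j <= J)%N -> \sum_(k < J.+1) g j k = p j n,
      forall k, (k <= J)%N -> \sum_(j < J.+1) g j k = p k n.+1 &
      forall j, (j <= J)%N -> \sum_(k < J.+1) (x k - x j) * g j k = 0].
Proof.
move=> nN.
pose W : lmodType R := nat -> nat -> R^o.
(* Rows 0, 1 and 2 of [w] are the multipliers of the first marginal, the second marginal and the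
   martingale condition. *)
pose al (c : 'I_J.+1 * 'I_J.+1) (w : W) : R :=
  w 0%N c.1 + w 1%N c.2 + (x c.2 - x c.1) * w 2 c.1.
pose ga (w : W) : R :=
  \sum_(j < J.+1) w 0%N j * p j n + \sum_(j < J.+1) w 1%N j * p j n.+1.
have [||[l l0 lE]|[w wl gw]] := farkas al ga.
- by move=> i a u v; rewrite /al !scale_addE; ring.
- move=> a u v; rewrite /ga mulrDr !mulr_sumr -!big_split /=.
  apply: eq_bigr => i _.
  by rewrite !scale_addE; ring.
- pose g (j k : nat) := l (inord j, inord k).
  have sumE (F : nat -> nat -> R) :
      \sum_i l i * F i.1 i.2 = \sum_(j < J.+1) \sum_(k < J.+1) g j k * F j k.
    rewrite pair_bigA /=; apply: eq_bigr => -[j k] _ /=.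
    by rewrite /g !inord_val.
  have delta i0 j0 : (j0 <= J)%N ->
      ga (fun i j => ((i == i0) && (j == j0))%:R) =
      (i0 == 0%N)%:R * p j0 n + (i0 == 1%N)%:R * p j0 n.+1.
    move=> j0J; rewrite /ga; congr (_ + _).
      rewrite eq_sym; case: eqP => _ /=; last first.
        by rewrite mul0r big1 // => j _; rewrite mul0r.
      rewrite mul1r -(sum_ord_delta J (p ^~ n) j0) //.
      by apply: eq_bigr => j _; rewrite mulrC.
    rewrite eq_sym; case: eqP => _ /=; last first.
      by rewrite mul0r big1 // => j _; rewrite mul0r.
    rewrite mul1r -(sum_ord_delta J (p ^~ n.+1) j0) //.
    by apply: eq_bigr => j _; rewrite mulrC.
  have gE w := etrans (lE w) (sumE (fun j k =>
    w 0%N j + w 1%N k + (x k - x j) * w 2 j)).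
  exists g; split.
  + by move=> j k; exact: l0.
  + move=> j jJ; have := gE (fun i j' => ((i == 0%N) && (j' == j))%:R).
    rewrite delta //= mul1r mul0r addr0 => ->.
    rewrite -(sum_ord_delta J (fun j => \sum_(k < J.+1) g j k) _ jJ).
    apply: eq_bigr => i _; rewrite mulr_suml; apply: eq_bigr => k _.
    by rewrite mulr0 !addr0.
  + move=> k kJ; have := gE (fun i j' => ((i == 1%N) && (j' == k))%:R).
    rewrite delta //= mul1r mul0r add0r => ->.
    apply: eq_bigr => i _; rewrite -(sum_ord_delta J (g i) _ kJ).
    by apply: eq_bigr => k' _; rewrite mulr0 !addr0 add0r.
  + move=> j jJ; have := gE (fun i j' => ((i == 2%N) && (j' == j))%:R).
    rewrite delta //= !mul0r addr0 => /esym.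
    rewrite -(sum_ord_delta J (fun j => \sum_(k < J.+1) (x k - x j) * g j k) _ jJ).
    move=> h; apply: etrans h; apply: eq_bigr => i _.
    rewrite mulr_suml; apply: eq_bigr => k _.
    by rewrite !add0r; ring.
- exfalso.
  (* A line lies below the envelope at its own base point, so [w 0 <= u], while the certificate
     gives [w 1 <= - u]; [0 < ga w] then contradicts the convex order. *)
  pose u := max_line (w 0%N) (w 2).
  have h1 : \sum_(j < J.+1) w 0%N j * p j n <= \sum_(j < J.+1) u j * p j n.
    apply: ler_sum => j _; rewrite ler_wpM2r ?pr_ge0 //; try by have := ltn_ord j; lia.
    have := le_max_line (w 0%N) (w 2) j j; rewrite subrr mul0r addr0; apply.
    by rewrite -ltnS.
  have h2 : \sum_(j < J.+1) w 1%N j * p j n.+1 <=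
            - \sum_(j < J.+1) u j * p j n.+1.
    rewrite -sumrN; apply: ler_sum => k _.
    rewrite -mulNr ler_wpM2r ?pr_ge0 //; try by have := ltn_ord k; lia.
    have [j jJ uE] := max_line_attained (w 0%N) (w 2) k.
    rewrite /u uE; have := wl (inord j, k); rewrite /al /= inordK //; lra.
  have := convex_order u n nN (max_line_convex _ _).
  by move: gw; rewrite /ga; lra.
Qed.

End Prices.

(** * Weak duality for an arbitrary model *)

Section SigmaAlgebra.
Context {T : Type} {G : set (set T)}.
Hypothesis sG : sigma_algebra setT G.

Lemma sigma_algebra_setC A : G A -> G (~` A).
Proof. by case: sG => _ GD _ GA; rewrite -setTD; exact: GD. Qed.

Lemma sigma_algebra_setU A B : G A -> G B -> G (A `|` B).
Proof.
move=> GA GB; case: sG => _ _ /(_ (fun n => if n is 0%N then A else B)) GU.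
have -> : A `|` B = \bigcup_n (if n is 0%N then A else B); last first.
  by apply: GU; case.
apply/seteqP; split => [w [Aw|Bw]|w [[|n] _ /= ?]].
- by exists 0%N.
- by exists 1%N.
- by left.
- by right.
Qed.

Lemma sigma_algebra_setI A B : G A -> G B -> G (A `&` B).
Proof.
move=> GA GB; rewrite -[_ `&` _]setCK setCI; apply: sigma_algebra_setC.
by apply: sigma_algebra_setU; apply: sigma_algebra_setC.
Qed.

Lemma sigma_algebra_cst (b : bool) : G [set w | b].
Proof.
have G0 : G set0 by case: sG.
case: b; last by rewrite (_ : [set _ | _] = set0) // -subset0.
rewrite (_ : [set _ | _] = ~` set0); first exact: sigma_algebra_setC.
by rewrite setC0; apply/seteqP; split.
Qed.

Lemma sigma_algebra_forall (I : finType) (Q : I -> T -> Prop) :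
  (forall i, G [set w | Q i w]) -> G [set w | forall i, Q i w].
Proof.
move=> GQ; suff : forall s : seq I, G [set w | forall i, i \in s -> Q i w].
  move=> /(_ (enum I)); congr G; apply/seteqP; split => w /= Qw i => [|_].
    by apply: Qw; rewrite mem_enum.
  exact: Qw.
elim=> [|i s IH].
  have := sigma_algebra_cst true; congr G; apply/seteqP; split => //.
rewrite (_ : [set _ | _] = [set w | Q i w] `&` [set w | forall i, i \in s -> Q i w]).
  exact: sigma_algebra_setI.
apply/seteqP; split => [w Qw|w [Qi Qs] j].
  by split=> [|j js]; apply: Qw; rewrite inE ?eqxx // js orbT.
by rewrite inE => /predU1P[->//|]; exact: Qs.
Qed.

End SigmaAlgebra.

Section FiniteValued.
Context {R : realType} {d : measure_display} {T : measurableType d}.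
Context {P : probability T R} {I : finType} {Z : T -> I}.
Hypothesis mZ : forall z, measurable [set w | Z w = z].

Lemma Pr_finite_valued (S : pred I) :
  Pr P [set w | S (Z w)] = \sum_z (S z)%:R * Pr P [set w | Z w = z].
Proof.
have mem_Z (s : seq I) : uniq s -> measurable [set w | Z w \in s] /\
    Pr P [set w | Z w \in s] = \sum_(z <- s) Pr P [set w | Z w = z].
  elim: s => [_|z s IH /= /andP[zs us]].
    rewrite big_nil (_ : [set _ | _] = set0); last by apply/seteqP; split.
    by rewrite /Pr measure0; split.
  have [ms Ps] := IH us.
  rewrite (_ : [set _ | _] = [set w | Z w = z] `|` [set w | Z w \in s]).
    split; first exact: measurableU.
    rewrite big_cons -Ps /Pr measureU //.
      by rewrite fineD // fin_num_measure.
    by apply/seteqP; split => // w /= [-> zs']; rewrite zs' in zs.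
  apply/seteqP; split => w /=; rewrite inE.
    by move=> /predU1P.
  by move=> /predU1P.
have us : uniq [seq z <- enum I | S z] by rewrite filter_uniq // enum_uniq.
have := (mem_Z _ us).2.
rewrite (_ : [set _ | _] = [set w | S (Z w)]).
  move=> ->; rewrite big_filter big_enum_cond /= big_mkcond /=.
  by apply: eq_bigr => z _; case: (S z); rewrite ?mul1r ?mul0r.
by apply/seteqP; split => w /=; rewrite mem_filter mem_enum andbT.
Qed.

End FiniteValued.

Section WeakDuality.
Context {R : realType} {J N : nat} {t x : nat -> R} {s0 : R}.
Context {c : nat -> nat -> R} {a : R -> R -> R}.
Context {d : measure_display} {T : measurableType d} {P : probability T R}.
Context {F : nat -> set (set T)} {X : nat -> T -> nat} {tau : T -> nat}.
Hypothesis mod : is_model P J N x s0 c F X.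
Hypothesis stop : is_stopping_time N F tau.

Local Notation outcomes := {ffun 'I_N.+1 -> 'I_J.+1 * bool}.

(* Index 0 carries no information: X 0 need not be measurable. *)
Definition outcome (w : T) : outcomes :=
  [ffun i : 'I_N.+1 => if i == ord0 then (ord0, false)
                       else (inord (X i w), tau w == i)].

(** Erasing the later coordinates, while staying in the same type, keeps exactly what is known at
    [t_n]. *)
Definition stopped (n : nat) (z : outcomes) :
    outcomes :=
  [ffun i : 'I_N.+1 => if (i <= n)%N then z i else (ord0, false)].

Local Notation pos z n := (val (z (inord n)).1).
Local Notation ex z n := (z (inord n)).2.

Lemma pos_le n (z : outcomes) : (pos z n <= J)%N.
Proof. by rewrite -ltnS; exact: ltn_ord. Qed.

Lemma outcomeE n w : (1 <= n <= N)%N ->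
  outcome w (inord n) = (inord (X n w), tau w == n).
Proof.
move=> nN; rewrite ffunE -val_eqE /= inordK; last lia.
by case: eqP => // n0; rewrite n0 in nN.
Qed.

Lemma pos_outcome n w : (1 <= n <= N)%N -> pos (outcome w) n = X n w.
Proof.
move=> nN; rewrite outcomeE //= inordK // ltnS; case: mod => _ + _ _ _; exact.
Qed.

Lemma ex_outcome n w : (1 <= n <= N)%N -> ex (outcome w) n = (tau w == n).
Proof. by move=> nN; rewrite outcomeE. Qed.

Lemma filtration_sigma n : (n <= N)%N -> sigma_algebra setT (F n).
Proof. by case: mod => -[sF _] _ _ _ _; exact: sF. Qed.

(** The coordinate at [i <= n] is fixed by [X i] and by whether [tau = i]; the latter is an event of
    [F i] because [tau] is a stopping time. *)
Lemma stopped_outcome_adapted n z : (n <= N)%N ->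
  F n [set w | stopped n (outcome w) = z].
Proof.
move=> nN; have sF := filtration_sigma n nN.
rewrite (_ : [set _ | _] = [set w | forall i, stopped n (outcome w) i = z i]).
  apply: (sigma_algebra_forall sF) => i.
  have [in_|ni] := leqP i n; last first.
    rewrite (_ : [set _ | _] = [set w | (ord0, false) == z i]).
      exact: sigma_algebra_cst.
    by apply/seteqP; split => w /=; rewrite ffunE leqNgt ni /= => /eqP.
  have [i0|i0] := eqVneq i ord0.
    rewrite (_ : [set _ | _] = [set w | (ord0, false) == z i]).
      exact: sigma_algebra_cst.
    by apply/seteqP; split => w /=; rewrite !ffunE in_ i0 /= => /eqP.
  have iN : (1 <= i <= N)%N.
    by rewrite (leq_trans in_ nN) andbT lt0n -(inj_eq val_inj) in i0 *.
  have [[_ [_ Fmon]] XJ FX _ _] := mod.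
  have Fi := Fmon i n _ _.
  rewrite (_ : [set _ | _] = ev X i (z i).1 `&`
      (if (z i).2 then [set w | tau w = i] else ~` [set w | tau w = i])).
    apply: (sigma_algebra_setI sF).
      by apply: Fi; [rewrite in_ nN|exact: FX].
    have Ft : F n [set w | tau w = i].
      by apply: Fi; [rewrite in_ nN|exact: stop.2].
    by case: (z i).2 => //; apply: (sigma_algebra_setC sF).
  apply/seteqP; split => w /=; rewrite !ffunE in_ (negPf i0) /ev.
    move=> <- /=; split; first by rewrite /= inordK // ltnS XJ.
    by case: eqP => /=.
  case=> Xi; case: (z i) Xi => k b /= Xi; rewrite Xi inord_val.
  by case: b => /= tw; congr pair; apply/eqP.
by apply/seteqP; split => w /= => [-> //|h]; apply/ffunP.
Qed.

Lemma outcome_measurable z : measurable [set w | outcome w = z].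
Proof.
have [[_ [mF _]] _ _ _ _] := mod.
have := mF N (leqnn N) _ (stopped_outcome_adapted N z (leqnn N)).
congr measurable; apply/seteqP.
suff h w : stopped N (outcome w) = outcome w by split => w /=; rewrite h.
by apply/ffunP => i; rewrite ffunE -ltnS ltn_ord.
Qed.

Local Notation q z := (Pr P [set w | outcome w = z]).

(** On the event that the stopped outcome equals [y] the holding is constant, and this event lies in
    [F n], so the martingale property applies to it. *)
Lemma trade_mean0 n (psi : outcomes -> R) :
  (1 <= n < N)%N ->
  \sum_(z : outcomes) psi (stopped n z) * (x (pos z n.+1) - x (pos z n)) * q z = 0.
Proof.
move=> nN; rewrite (partition_big (stopped n) xpredT) //= big1 // => y _.
have -> : \sum_(z | stopped n z == y)
    psi (stopped n z) * (x (pos z n.+1) - x (pos z n)) * q z =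
  psi y * \sum_(z | stopped n z == y)
    (x (pos z n.+1) - x (pos z n)) * q z.
  by rewrite mulr_sumr; apply: eq_bigr => z /eqP ->; rewrite mulrA.
pose A := [set w | stopped n (outcome w) = y].
have FA : F n A by apply: stopped_outcome_adapted; lia.
have PA m : (1 <= m <= N)%N -> \sum_(k < J.+1) x k * Pr P (A `&` ev X m k) =
    \sum_(z | stopped n z == y) x (pos z m) * q z.
  move=> mN; rewrite [RHS]big_mkcond /=.
  transitivity (\sum_(k < J.+1) \sum_(z : outcomes)
      x k * (((stopped n z == y) && (pos z m == k))%:R * q z)).
    apply: eq_bigr => k _; rewrite -mulr_sumr.
    rewrite -(Pr_finite_valued outcome_measurable
      (fun z : outcomes => (stopped n z == y) && (pos z m == k))).
    congr (_ * Pr P _); apply/seteqP; split => w /=; rewrite /A /ev /=.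
      by move=> [<- Xk]; rewrite pos_outcome // Xk !eqxx.
    by rewrite pos_outcome // => /andP[/eqP <- /eqP ->].
  rewrite exchange_big /=; apply: eq_bigr => z _.
  case: eqP => _ /=; last by rewrite big1 // => k _; rewrite mul0r mulr0.
  rewrite -(sum_ord_delta J x (pos z m)); last exact: pos_le.
  by rewrite mulr_suml; apply: eq_bigr => k _; rewrite eq_sym mulrA.
have [_ _ _ mart _] := mod.
have := mart n _ A FA; rewrite ifF; last by case: n nN {A FA PA}.
rewrite !PA; try lia.
move=> mE; under eq_bigr do rewrite mulrBl.
by rewrite sumrB mE ?subrr ?mulr0 //; lia.
Qed.

Lemma exp_payoff_le_cost b Th1 Th2 :
  nonanticipative N Th1 Th2 -> superreplicates J N t x a b Th1 Th2 ->
  exp_payoff P J N t x a X tau <= cost J N x s0 c b.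
Proof.
move=> nonant sup.
(* The two holdings merge into a single function of the stopped outcome: a visible exercise flag
   selects [Th2] with its date, and no flag selects [Th1]. *)
pose th n (y : outcomes) : R :=
  if [pick i | (y i).2] is Some i then Th2 n (fun m => pos y m) i
  else Th1 n (fun m => pos y m).
have -> : exp_payoff P J N t x a X tau =
    \sum_(z : outcomes) (\sum_(1 <= n < N.+1) (ex z n)%:R * a (x (pos z n)) (t n)) * q z.
  rewrite /exp_payoff; under [RHS]eq_bigr do rewrite mulr_suml.
  rewrite [RHS]exchange_big /=; apply: eq_big_nat => n nN.
  transitivity (\sum_(j < J.+1) \sum_(z : outcomes)
      a (x j) (t n) * ((ex z n && (pos z n == j))%:R * q z)).
    apply: eq_bigr => j _; rewrite -mulr_sumr.
    rewrite -(Pr_finite_valued outcome_measurable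
      (fun z : outcomes => ex z n && (pos z n == j))).
    congr (_ * Pr P _); apply/seteqP; split => w /=; rewrite /ev /=.
      by move=> [tn Xj]; rewrite ex_outcome // pos_outcome // tn Xj !eqxx.
    by rewrite ex_outcome // pos_outcome // => /andP[/eqP ? /eqP].
  rewrite exchange_big /=; apply: eq_bigr => z _.
  case: (ex z n) => /=; last first.
    by rewrite big1 => [|j _]; rewrite !(mul0r, mulr0).
  rewrite mul1r; have /= <- := sum_ord_delta J (fun j => a (x j) (t n)) _ (pos_le n z).
  by rewrite mulr_suml; apply: eq_bigr => k _; rewrite eq_sym mulrA.
have -> : cost J N x s0 c b =
    \sum_(z : outcomes) (\sum_(1 <= n < N.+1) b (pos z n) n) * q z.
  rewrite /cost; under [RHS]eq_bigr do rewrite mulr_suml.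
  rewrite [RHS]exchange_big /=; apply: eq_big_nat => n nN.
  transitivity (\sum_(j < J.+1) \sum_(z : outcomes) b j n * ((pos z n == j)%:R * q z)).
    apply: eq_bigr => j _; rewrite -mulr_sumr.
    rewrite -(Pr_finite_valued outcome_measurable (fun z : outcomes => pos z n == j)).
    have [_ _ _ _ <-] := mod; rewrite // -1?ltnS //.
    congr (_ * Pr P _); apply/seteqP; split => w /=; rewrite /ev /=.
      by move=> Xj; rewrite pos_outcome // Xj eqxx.
    by rewrite pos_outcome // => /eqP.
  rewrite exchange_big /=; apply: eq_bigr => z _.
  rewrite -(sum_ord_delta J (b^~ n) (pos z n)); last exact: pos_le.
  by rewrite mulr_suml; apply: eq_bigr => k _; rewrite eq_sym mulrA.
have trades0 : \sum_(z : outcomes) (\sum_(1 <= n < N)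
    th n (stopped n z) * (x (pos z n.+1) - x (pos z n))) * q z = 0.
  under eq_bigr do rewrite mulr_suml.
  rewrite exchange_big /= big_nat big1 // => n nN.
  exact: trade_mean0.
rewrite -[leRHS]addr0 -[X in _ <= _ + X]trades0 -big_split /=; apply: ler_sum => z _.
rewrite -mulrDl.
(* Super-replication speaks only of outcomes realised by some path and exercise date; the others
   carry no mass. *)
have [[w <-]|nz] := pselect (exists w, outcome w = z); last first.
  rewrite (_ : [set _ | _] = set0) /Pr ?measure0 ?mulr0 //.
  by apply/seteqP; split => // w wz; case: nz; exists w.
rewrite ler_wpM2r //; first by rewrite /Pr fine_ge0.
have [tauN _] := stop; have tN := tauN w.
have XJ : forall n, (1 <= n <= N)%N -> (X n w <= J)%N.
  by move=> n nN; case: mod => _ XJ _ _ _; exact: XJ.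
have := sup (fun n => X n w) XJ (tau w) tN.
rewrite /gain -addrA; congr (_ <= _ + _).
- rewrite (bigD1_seq (tau w)) ?iota_uniq //=; last first.
    by rewrite mem_index_iota; lia.
  rewrite ex_outcome // pos_outcome // eqxx mul1r big_seq_cond big1 ?addr0 //.
  move=> n /andP[]; rewrite mem_index_iota => nN nt.
  by rewrite ex_outcome // eq_sym (negPf nt) mul0r.
- apply: eq_big_nat => n nN; rewrite pos_outcome //.
  rewrite -(sum_ord_delta J (b^~ n) (X n w)) ?XJ //.
  by apply: eq_bigr => j _; rewrite eq_sym.
have posE n m : (1 <= m <= n)%N -> (n < N)%N ->
    pos (stopped n (outcome w)) m = X m w.
  move=> mn nN; rewrite ffunE inordK; last lia.
  by rewrite ifT; [rewrite pos_outcome //; lia|lia].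
have agree n : (1 <= n < N)%N -> forall m, (1 <= m <= n)%N ->
    (fun m => X m w) m = (fun m => pos (stopped n (outcome w)) m) m.
  by move=> nN m mn /=; rewrite posE //; lia.
have [tau1 tau2] := andP tN.
(* The flag is already visible at [n = tau w], which matches [Th2] being held from the exercise date
   on. *)
rewrite [RHS](@big_cat_nat _ _ _ (tau w)) //=.
congr (_ + _); apply: eq_big_nat => n nt.
- have nN : (1 <= n < N)%N by lia.
  rewrite !pos_outcome; try lia.
  congr (_ * _); rewrite /th; case: pickP => [i|_].
    rewrite ffunE; case: leqP => // in_.
    rewrite ffunE; case: ifP => //= _ /eqP ti; lia.
  by have [-> _] := nonant n nN _ _ (agree n nN).
- have nN : (1 <= n < N)%N by lia.
  rewrite !pos_outcome; try lia.
  congr (_ * _); rewrite /th; case: pickP => [i|/(_ (inord (tau w)))]; last first.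
    rewrite ffunE inordK; last lia.
    by rewrite ifT ?ex_outcome ?eqxx //; lia.
  rewrite ffunE; case: leqP => // in_; rewrite ffunE; case: ifP => //= _ /eqP <-.
  by have [_ ->] := nonant n nN _ _ (agree n nN).
Qed.

End WeakDuality.

(** * Price/regime chains *)

Lemma discrete_probability {R : realType} (m : nat) (w : nat -> R) :
  (forall i, 0 <= w i) -> \sum_(i < m) w i = 1 ->
  exists P : probability nat R,
    forall A, Pr P A = \sum_(i < m) w i * (i%:R \in A : bool)%:R.
Proof.
move=> w0 w1.
pose mu := msum (fun i => mscale (NngNum (w0 i)) (\d_i : {measure set nat -> \bar R})) m.
have muE A : mu A = (\sum_(i < m) w i * ((i : nat) \in A)%:R)%:E.
  rewrite /mu /msum /= -sumEFin; apply: eq_bigr => i _.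
  by rewrite /mscale /= diracE EFinM.
have mu1 : mu setT = 1%E.
  rewrite muE; congr EFin; rewrite -[RHS]w1; apply: eq_bigr => i _.
  by rewrite in_setT mulr1.
exists (HB.pack_for (probability nat R) mu
  (Measure_isProbability.Build _ _ _ mu mu1)) => A.
rewrite /Pr [X in fine X](_ : _ = mu A) // muE /=.
by apply: eq_bigr => i _; rewrite natn.
Qed.

Section Chain.
Context {R : realType} {J N : nat}.
Variables (p1 : nat -> R) (K : bool -> nat -> nat -> nat -> R).
Variable h : nat -> nat -> R.

(* A history lists, most recent first, the visited lattice indices together with
   a flag telling whether a regime switch is triggered on arrival (irrelevant
   after the first switch). [K true] and [K false] are the kernels of regimes 1
   and 2, [h n k] is the probability of a switch on arrival in [k] at [t_n]. *)
Definition history := seq ('I_J.+1 * bool).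
Implicit Types l : history.

Definition switched l := has snd l.
Definition pos l : nat := if l is s :: _ then s.1 : nat else 0%N.
Definition move l (k : nat) : R :=
  if l is s :: _ then K (~~ switched l) (size l) s.1 k else p1 k.
Definition flag (n k : nat) (b : bool) : R := if b then h n k else 1 - h n k.
Definition step l (s : 'I_J.+1 * bool) : R :=
  move l s.1 * flag (size l).+1 s.1 s.2.

Fixpoint weight l : R := if l is s :: l' then step l' s * weight l' else 1.
Fixpoint histories n : seq history :=
  if n is n'.+1 then [seq s :: l | l <- histories n', s <- enum {: 'I_J.+1 * bool}]
  else [:: [::]].
Definition expect n (phi : history -> R) : R :=
  \sum_(l <- histories n) weight l * phi l.

Lemma size_histories n l : l \in histories n -> size l = n.
Proof.
elim: n l => [|n IH] l /=; first by rewrite inE => /eqP ->.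
by move=> /allpairsP[[l' s] [/= /IH <- _ ->]].
Qed.

Lemma eq_expect n phi psi : (forall l, size l = n -> phi l = psi l) ->
  expect n phi = expect n psi.
Proof.
move=> e; apply: eq_big_seq => l /size_histories sl.
by rewrite e.
Qed.

Lemma expectZ n r phi : expect n (fun l => r * phi l) = r * expect n phi.
Proof. by rewrite mulr_sumr; apply: eq_bigr => l _; rewrite mulrCA. Qed.

Lemma expect_sum n (I : finType) (phi : I -> history -> R) :
  expect n (fun l => \sum_i phi i l) = \sum_i expect n (phi i).
Proof.
by rewrite exchange_big /=; apply: eq_bigr => l _; rewrite mulr_sumr.
Qed.

Lemma expect0 phi : expect 0 phi = phi [::].
Proof. by rewrite /expect big_seq1 mul1r. Qed.

Lemma expectS n phi :
  expect n.+1 phi = expect n (fun l => \sum_s step l s * phi (s :: l)).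
Proof.
rewrite /expect /= big_allpairs_dep; apply: eq_bigr => l _.
rewrite mulr_sumr big_enum /=; apply: eq_bigr => s _; ring.
Qed.

Hypothesis p1_ge0 : forall k, (k <= J)%N -> 0 <= p1 k.
Hypothesis p1_sum : \sum_(k < J.+1) p1 k = 1.
Hypothesis K_ge0 : forall dl n j k, (j <= J)%N -> (k <= J)%N -> 0 <= K dl n j k.
Hypothesis K_sum : forall dl n j, (j <= J)%N -> \sum_(k < J.+1) K dl n j k = 1.
Hypothesis h01 : forall n k, (k <= J)%N -> 0 <= h n k <= 1.

Lemma ord_leq (k : 'I_J.+1) : (k <= J)%N.
Proof. by rewrite -ltnS. Qed.
Hint Resolve ord_leq : core.

Lemma weight_ge0 l : 0 <= weight l.
Proof.
elim: l => //= s l IH; rewrite mulr_ge0 // mulr_ge0 //.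
  by case: l {IH} => [|s' l] /=; [exact: p1_ge0|exact: K_ge0].
rewrite /flag; case: ifP => _; have := h01 (size l).+1 s.1 (ord_leq _); lra.
Qed.

Lemma sum_step l (psi : nat -> bool -> R) :
  \sum_s step l s * psi s.1 s.2 =
  \sum_(k < J.+1) move l k * \sum_b flag (size l).+1 k b * psi k b.
Proof.
transitivity (\sum_(k < J.+1) \sum_b step l (k, b) * psi k b).
  by rewrite pair_bigA; apply: eq_bigr => -[].
apply: eq_bigr => k _; rewrite mulr_sumr; apply: eq_bigr => b _.
by rewrite /step /= mulrA.
Qed.

Lemma sum_step_pos l (psi : nat -> R) :
  \sum_s step l s * psi s.1 = \sum_(k < J.+1) move l k * psi k.
Proof.
rewrite (sum_step l (fun k _ => psi k)); apply: eq_bigr => k _.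
by rewrite big_bool /flag /=; ring.
Qed.

Lemma sum_move l : \sum_(k < J.+1) move l k = 1.
Proof. by case: l => [|s l]; [exact: p1_sum|exact: K_sum]. Qed.

(** Consistency of the laws: each step has total mass one, so summing out the latest steps changes
    nothing. *)
Lemma expect_drop m n phi : (n <= m)%N ->
  expect m (fun l => phi (drop (m - n) l)) = expect n phi.
Proof.
elim: m => [|m IH]; first by rewrite leqn0 => /eqP ->; apply: eq_bigr => l; rewrite drop0.
rewrite leq_eqVlt => /predU1P[->|nm].
  by apply: eq_bigr => l _; rewrite subnn drop0.
rewrite expectS -IH //; apply: eq_bigr => l _; rewrite subSn //=.
rewrite -mulr_suml (_ : \sum_i _ = 1) ?mul1r //.
have := sum_step_pos l (fun=> 1).
under eq_bigr do rewrite mulr1; under [in RHS]eq_bigr do rewrite mulr1.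
by rewrite sum_move.
Qed.

(** Histories are coded by their rank. The default value also has length [N], so [size_decode] holds
    for every natural number, including those of mass zero. *)
Definition decode (w : nat) : history := nth (nseq N (ord0, false)) (histories N) w.

Lemma size_decode w : size (decode w) = N.
Proof.
have [wN|wN] := ltnP w (size (histories N)).
  by apply: size_histories; rewrite mem_nth.
by rewrite /decode nth_default // size_nseq.
Qed.

Lemma chain_probability : exists P : probability nat R,
  forall phi : pred history,
    Pr P [set w | phi (decode w)] = expect N (fun l => (phi l)%:R).
Proof.
have expectE phi : expect N phi =
    \sum_(i < size (histories N)) weight (decode i) * phi (decode i).
  by rewrite /expect (big_nth (nseq N (ord0, false))) big_mkord.
have [//||P PE] := discrete_probability (size (histories N)) (weight \o decode).
- by move=> i; exact: weight_ge0.
- have := expect_drop N 0 (fun=> 1) (leq0n N); rewrite expect0 expectE => e.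
  by rewrite -[RHS]e; apply: eq_bigr => i _; rewrite mulr1.
exists P => phi; rewrite PE expectE; apply: eq_bigr => i _.
by rewrite natn; congr (_ * (nat_of_bool _)%:R); apply/idP/idP; rewrite inE.
Qed.

(** * The canonical process on histories *)

Definition hist n w := drop (N - n) (decode w).

Lemma size_hist n w : (n <= N)%N -> size (hist n w) = n.
Proof. by move=> nN; rewrite size_drop size_decode subKn. Qed.

Lemma hist0 w : hist 0 w = [::].
Proof. by apply/nilP; rewrite /nilp size_hist. Qed.

Lemma hist_cons n w : (n < N)%N ->
  exists s, hist n.+1 w = s :: hist n w.
Proof.
move=> nN; rewrite /hist (drop_nth (ord0, false)); last by rewrite size_decode; lia.
by rewrite subnSK //; eexists.
Qed.

Lemma hist_drop n m w : (n <= m <= N)%N -> hist n w = drop (m - n) (hist m w).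
Proof. by move=> nm; rewrite /hist drop_drop; congr drop; lia. Qed.

Definition chain_X n w := pos (hist n w).
(** Regime 2 is imposed at the final date whether or not a switch was triggered. *)
Definition chain_D n w := if n == N then 2%N else (switched (hist n w)).+1.
Definition chain_F n : set (set nat) :=
  [set A | exists phi : pred history, A = [set w | phi (hist n w)]].

Lemma chain_filtration : is_filtration N chain_F.
Proof.
split; [|split].
- move=> n _; split.
  + by exists pred0; apply/seteqP; split.
  + move=> _ [phi ->]; exists (predC phi); apply/seteqP; split => w /=.
      by move=> [_ /negP].
    by move=> /negP.
  + move=> A FA.
    (* Each [A k] is a union of fibres of [hist n], so a history lies in the union as soon as one
       point of its fibre does. *)
    exists (fun l => `[< exists k w, A k w /\ hist n w = l >]).
    apply/seteqP; split => w /=.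
      by move=> [k _ Akw]; apply/asboolP; exists k, w.
    move=> /asboolP[k [w' [Ak e]]]; exists k => //.
    by have [phi AE] := FA k; move: Ak; rewrite AE /= e.
- by [].
- move=> n m nm _ [phi ->]; exists (fun l => phi (drop (m - n) l)).
  by apply/seteqP; split => w /=; rewrite (hist_drop n m w nm).
Qed.

Lemma chain_X_le n w : (chain_X n w <= J)%N.
Proof. by rewrite /chain_X; case: (hist n w) => [|s l] //=; exact: ord_leq. Qed.

Lemma chain_X_adapted n j : chain_F n (ev chain_X n j).
Proof.
by exists (fun l => pos l == j); apply/seteqP; split => w /= /eqP.
Qed.

Lemma chain_D_adapted n i : chain_F n (ev chain_D n i).
Proof.
exists (fun l => (if n == N then 2 else (switched l).+1) == i).
by apply/seteqP; split => w /= /eqP.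
Qed.

Variable P : probability nat R.
Hypothesis PE : forall phi : pred history,
  Pr P [set w | phi (decode w)] = expect N (fun l => (phi l)%:R).

Lemma Pr_hist n (phi : pred history) : (n <= N)%N ->
  Pr P [set w | phi (hist n w)] = expect n (fun l => (phi l)%:R).
Proof.
move=> nN; rewrite (PE (fun l => phi (drop (N - n) l))).
exact: (expect_drop N n (fun l => (phi l)%:R)).
Qed.

Lemma Pr_hist_next n (phi : pred history) k : (n < N)%N -> (k <= J)%N ->
  Pr P ([set w | phi (hist n w)] `&` ev chain_X n.+1 k) =
  expect n (fun l => (phi l)%:R * move l k).
Proof.
move=> nN kJ.
pose theta : pred history := fun l => phi (behead l) && (pos l == k).
rewrite (_ : _ `&` _ = [set w | theta (hist n.+1 w)]).
  rewrite Pr_hist // expectS; apply: eq_bigr => l _; congr (_ * _).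
  rewrite /theta /=.
  rewrite (sum_step_pos l (fun j => (phi l && (j == k))%:R)).
  rewrite -(sum_ord_delta J (move l) k) // mulr_sumr.
  by apply: eq_bigr => j _; case: (phi l); case: (j == k :> nat) => /=; ring.
apply/seteqP; split => w; rewrite /theta /ev /chain_X /=; have [s ->] := hist_cons n w nN.
  by move=> [-> ->] /=.
by move=> /= /andP[-> /eqP].
Qed.

Lemma Pr_hist_next_switch n (phi : pred history) k : (n < N)%N -> (k <= J)%N ->
  Pr P [set w | phi (hist n w) && ((chain_X n.+1 w == k) &&
     (switched (hist n.+1 w) && ~~ switched (hist n w)))] =
  expect n (fun l => (phi l && ~~ switched l)%:R * (h n.+1 k * move l k)).
Proof.
move=> nN kJ.
pose theta : pred history := fun l =>
  phi (behead l) && ((pos l == k) && (switched l && ~~ switched (behead l))).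
rewrite (_ : [set w | _] = [set w | theta (hist n.+1 w)]).
  rewrite Pr_hist // expectS; apply: eq_expect => l sl; rewrite /theta /=.
  rewrite (sum_step l (fun j b => (phi l && ((j == k) &&
    ((b || switched l) && ~~ switched l)))%:R)).
  rewrite -(sum_ord_delta J (fun k => h n.+1 k * move l k) k) // mulr_sumr.
  apply: eq_bigr => j _; rewrite big_bool /= sl.
  by case: (phi l); case: (switched l); case: (j == k :> nat) => /=; ring.
by apply/seteqP; split => w; rewrite /theta /chain_X /=; have [s ->] := hist_cons n w nN.
Qed.


(** * Law of the chain attached to a primal solution *)

Context {t x : nat -> R} {s0 : R} {c : nat -> nat -> R} {a : R -> R -> R}.
Context {f : nat -> nat -> R} {g : bool -> nat -> nat -> nat -> R}.
Local Notation p := (pr J x s0 c).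
Hypothesis N_gt0 : (0 < N)%N.
Hypothesis p1E : forall k, p1 k = p k 1%N.
Hypothesis p1_mean : \sum_(k < J.+1) x k * p1 k = s0.
Hypothesis K_mean : forall dl n j, (j <= J)%N ->
  \sum_(k < J.+1) x k * K dl n j k = x j.
Hypothesis feas : primal_feasible J N x s0 c f g.
Hypothesis gK : forall dl n j k, (1 <= n < N)%N -> (j <= J)%N -> (k <= J)%N ->
  (\sum_(i < J.+1) g dl j i n) * K dl n j k = g dl j k n.
Hypothesis h_first : forall k, (1 < N)%N -> (k <= J)%N ->
  h 1 k * p1 k = \sum_(i < J.+1) g false k i 1.
Hypothesis h_next : forall n k, (0 < n)%N -> (n.+1 < N)%N -> (k <= J)%N ->
  h n.+1 k * \sum_(i < J.+1) g true i k n =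
  \sum_(i < J.+1) g false k i n.+1 - \sum_(i < J.+1) g false i k n.

Lemma move_pos l k n : size l = n -> (0 < n)%N ->
  move l k = K (~~ switched l) n (pos l) k.
Proof. by case: l => [<-//|s l] <-. Qed.

Lemma pos_le_J l : (pos l <= J)%N.
Proof. by case: l => [//|s l] /=; exact: ord_leq. Qed.

Lemma expect_decomp n (th : bool -> nat -> R) :
  expect n (fun l => th (switched l) (pos l)) =
  \sum_b \sum_(j < J.+1)
    th b j * expect n (fun l => ((switched l == b) && (pos l == j))%:R).
Proof.
under eq_bigr => b _ do
  (under eq_bigr => j _ do rewrite -expectZ; rewrite -expect_sum).
rewrite -expect_sum; apply: eq_expect => l _.
rewrite (bigD1 (switched l)) //= [X in _ + X]big1 ?addr0 => [|b bl].
  rewrite -(sum_ord_delta J _ _ (pos_le_J l)); apply: eq_bigr => j _.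
  by rewrite eqxx eq_sym.
by rewrite big1 // => j _; rewrite eq_sym (negPf bl) mulr0.
Qed.

(** Invariant: the mass at a node in a regime equals the flow leaving it in that regime. Regime 2
    mass is the regime 2 inflow plus the fraction [h] of the regime 1 inflow, which [h_next] matches
    with the outflow; (a) and (b) then settle regime 1. *)
Lemma expect_flow n b j : (1 <= n < N)%N -> (j <= J)%N ->
  expect n (fun l => ((switched l == b) && (pos l == j))%:R) =
  \sum_(k < J.+1) g (~~ b) j k n.
Proof.
have [_ fa _ _ _] := feas.
elim: n b j => // n IH b j nN jJ.
have step1 m l : size l = m ->
    \sum_s step l s * ((switched (s :: l) == b) && (pos (s :: l) == j))%:R =
    move l j * (if switched l then (b : nat)%:R else flag m.+1 j b).
  move=> sl; rewrite (sum_step l (fun k e => (((e || switched l) == b) && (k == j))%:R)).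
  rewrite -(sum_ord_delta J (fun k => move l k * _) j) //; apply: eq_bigr => k _.
  rewrite big_bool sl /flag /=.
  by case: (switched l); case: b; case: (k == j :> nat) => /=; ring.
have [n0|n0] := posnP n.
  move: nN; rewrite n0 => nN; rewrite expectS expect0 (step1 0) //=.
  have := fa j 1%N jJ nN; rewrite big_split /= -p1E.
  by have := h_first j nN jJ; rewrite /flag; case: b {step1} => /=; lra.
have nN' : (1 <= n < N)%N by lia.
rewrite expectS.
pose th e i := K (~~ e) n i j * (if e then (b : nat)%:R else flag n.+1 j b).
rewrite (@eq_expect n _ (fun l => th (switched l) (pos l))); last first.
  by move=> l sl; rewrite (step1 n) // /th (move_pos l j n sl n0).
rewrite expect_decomp big_bool /=.
have flow e : \sum_(i < J.+1) th e i *
      expect n (fun l => ((switched l == e) && (pos l == i))%:R) =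
    (if e then (b : nat)%:R else flag n.+1 j b) * \sum_(i < J.+1) g (~~ e) i j n.
  rewrite mulr_sumr; apply: eq_bigr => i _; rewrite IH // /th.
  by rewrite -(gK (~~ e) n i j) //; ring.
rewrite !flow /flag /=.
have [_ nN1] := andP nN; have nN2 : (2 <= n.+1 <= N)%N by lia.
have [_ _ fb _ _] := feas.
have := h_next n j n0 nN1 jJ; have := fa j n.+1 jJ nN; have := fb j n.+1 jJ nN2.
rewrite !big_split /=.
by case: b {step1 th flow} => /=; lra.
Qed.

Lemma expect_next n (th : bool -> R) k : (1 <= n < N)%N -> (k <= J)%N ->
  expect n (fun l => th (switched l) * move l k) =
  \sum_b th b * \sum_(j < J.+1) g (~~ b) j k n.
Proof.
move=> nN kJ; have [n0 _] := andP nN.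
rewrite (@eq_expect n _ (fun l =>
    th (switched l) * K (~~ switched l) n (pos l) k)); last first.
  by move=> l sl; rewrite (move_pos l k n sl n0).
rewrite (expect_decomp n (fun e j => th e * K (~~ e) n j k)).
apply: eq_bigr => b _; rewrite mulr_sumr; apply: eq_bigr => j _.
by rewrite expect_flow // -[in RHS](gK (~~ b) n j k) //; ring.
Qed.

Lemma chain_X_empty n k : (J < k)%N -> ev chain_X n k = set0.
Proof.
move=> Jk; apply/seteqP; split => // w; rewrite /ev /= => Xw.
by have := chain_X_le n w; rewrite Xw leqNgt Jk.
Qed.

Lemma chain_D_12 n w : chain_D n w = 1%N \/ chain_D n w = 2%N.
Proof. by rewrite /chain_D; case: ifP; [right|case: switched; [right|left]]. Qed.

Lemma chain_DE n w : (n < N)%N -> chain_D n w = (switched (hist n w)).+1.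
Proof. by rewrite /chain_D; case: eqP => // ->; rewrite ltnn. Qed.

Lemma chain_marginal n j : (1 <= n <= N)%N -> (j <= J)%N ->
  Pr P (ev chain_X n j) = p j n.
Proof.
case: n => // n nN jJ.
have -> : ev chain_X n.+1 j = [set w | predT (hist n w)] `&` ev chain_X n.+1 j.
  by apply/seteqP; split => w // [].
rewrite Pr_hist_next //.
have [n0|n0] := posnP n; first by rewrite n0 expect0 mul1r /= p1E.
rewrite (expect_next n (fun=> 1)) //; last lia.
have [_ _ fb _ _] := feas; rewrite -(fb j n.+1) //; last lia.
by rewrite big_bool /= !mul1r big_split /= addrC.
Qed.

Lemma chain_martingale n A : (n < N)%N -> chain_F n A ->
  \sum_(k < J.+1) x k * Pr P (A `&` ev chain_X n.+1 k) =
  (if n == 0%N then s0 * Pr P A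
   else \sum_(k < J.+1) x k * Pr P (A `&` ev chain_X n k)).
Proof.
move=> nN [phi ->].
under eq_bigr => k _ do rewrite Pr_hist_next // -expectZ.
rewrite -expect_sum; case: ifP => [/eqP n0|/negbT n0].
  rewrite n0 Pr_hist // !expect0 -p1_mean mulr_suml; apply: eq_bigr => k _ /=.
  ring.
have -> : \sum_(k < J.+1) x k * Pr P ([set w | phi (hist n w)] `&` ev chain_X n k) =
    \sum_(k < J.+1) expect n (fun l => x k * (phi l && (pos l == k))%:R).
  apply: eq_bigr => k _.
  rewrite expectZ -(Pr_hist n (fun l => phi l && (pos l == k))) //; last exact: ltnW.
  congr (_ * Pr P _); apply/seteqP; split => w /=; rewrite /ev /chain_X /=.
    by move=> [-> ->] /=.
  by move=> /andP[-> /eqP].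
rewrite -expect_sum; apply: eq_expect => l sl.
have lJ := pos_le_J l.
transitivity ((phi l)%:R * x (pos l)).
  rewrite -(K_mean (~~ switched l) n (pos l)) // mulr_sumr; apply: eq_bigr => k _.
  by rewrite (move_pos l k n) // ?lt0n // mulrCA.
rewrite -(sum_ord_delta J x _ lJ) mulr_sumr; apply: eq_bigr => k _.
by rewrite eq_sym; case: (phi l); case: eqP => /= _; ring.
Qed.

Lemma chain_model : is_model P J N x s0 c chain_F chain_X.
Proof.
split.
- exact: chain_filtration.
- by move=> n _ w; exact: chain_X_le.
- by move=> n _ j; exact: chain_X_adapted.
- by move=> n nN A FA; exact: chain_martingale.
- by move=> n nN j jJ; exact: chain_marginal.
Qed.

Lemma chain_D_mono n w : (n < N)%N -> (chain_D n w <= chain_D n.+1 w)%N.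
Proof.
move=> nN; rewrite chain_DE // /chain_D; case: ifP => _.
  by case: switched.
have [s ->] := hist_cons n w nN.
by rewrite /switched /=; case: s.2; case: has.
Qed.

Lemma chain_markov n A j i k : (1 <= n < N)%N -> chain_F n A ->
  Pr P (A `&` (ev chain_X n j `&` ev chain_D n i) `&` ev chain_X n.+1 k) =
  (if (k <= J)%N then K (i == 1%N) n j k else 0) *
  Pr P (A `&` (ev chain_X n j `&` ev chain_D n i)).
Proof.
move=> nN [phi ->]; have [n0 nltN] := andP nN.
case: leqP => kJ; last by rewrite (chain_X_empty n.+1 k) // setI0 /Pr measure0 mul0r.
pose theta : pred history := fun l =>
  phi l && ((pos l == j) && ((switched l).+1 == i)).
rewrite (_ : _ `&` (_ `&` _) = [set w | theta (hist n w)]).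
  rewrite Pr_hist_next // Pr_hist // ?(ltnW nltN) // -expectZ.
  apply: eq_expect => l sl; rewrite /theta.
  case: (phi l) => /=; rewrite ?mul0r ?mulr0 //.
  case: eqP => [<-|] /=; rewrite ?mul0r ?mulr0 //.
  case: eqP => [<-|] /=; rewrite ?mul0r ?mulr0 //.
  by rewrite mulr1 mul1r (move_pos l k n) //; case: switched.
apply/seteqP; split => w; rewrite /ev /chain_X /theta /= chain_DE //.
  by move=> [-> [-> ->]]; rewrite !eqxx.
by move=> /andP[-> /andP[/eqP -> /eqP ->]].
Qed.

Lemma chain_initial A k : chain_F 0 A ->
  Pr P (A `&` ev chain_X 1 k) = Pr P A * Pr P (ev chain_X 1 k).
Proof.
move=> [phi ->].
have [kJ|kJ] := leqP k J; last by rewrite chain_X_empty // setI0 /Pr measure0 mulr0.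
rewrite Pr_hist_next // Pr_hist // chain_marginal // !expect0 /=.
by rewrite p1E.
Qed.

(** On arrival at [t_N] the switch is certain, so the function is 1 there; earlier it is
    [h n.+1]. *)
Lemma chain_switch n : (n < N)%N -> exists h' : nat -> R,
  forall A k, chain_F n A ->
    Pr P (A `&` ev chain_D n 1 `&` ev chain_X n.+1 k `&` ev chain_D n.+1 2) =
    h' k * Pr P (A `&` ev chain_D n 1 `&` ev chain_X n.+1 k).
Proof.
move=> nN; have [n1N|n1N] := eqVneq n.+1 N.
  exists (fun=> 1) => A k _; rewrite mul1r; congr (Pr P _).
  apply/seteqP; split => w; first by case.
  by move=> ?; split => //; rewrite /ev /chain_D /= n1N eqxx.
exists (h n.+1) => A k [phi ->].
have [kJ|kJ] := leqP k J; last by rewrite chain_X_empty // setI0 set0I /Pr measure0 mulr0.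
have nN1 : (n.+1 < N)%N by lia.
rewrite (_ : _ `&` ev chain_D n.+1 2 =
    [set w | phi (hist n w) && ((chain_X n.+1 w == k) &&
     (switched (hist n.+1 w) && ~~ switched (hist n w)))]).
  rewrite Pr_hist_next_switch //.
  rewrite (_ : _ `&` ev chain_D n 1 =
      [set w | (fun l => phi l && ~~ switched l) (hist n w)]).
    rewrite (Pr_hist_next n (fun l => phi l && ~~ switched l)) // -expectZ.
    by apply: eq_expect => l _; rewrite mulrCA.
  apply/seteqP; split => w; rewrite /ev /= chain_DE //.
    by move=> [->]; case: switched.
  by move=> /andP[-> /negPf ->].
apply/seteqP; split => w; rewrite /ev /= !chain_DE //.
  by move=> [[[-> ] +] -> +]; rewrite eqxx; do 2 case: switched.
by move=> /andP[-> /andP[/eqP -> /andP[-> /negPf ->]]].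
Qed.

Lemma chain_model2 : is_model2 P J N x s0 c chain_F chain_X chain_D.
Proof.
split.
- exact: chain_model.
- split=> [n _ w|n _ i]; last exact: chain_D_adapted.
  exact: chain_D_12.
- split=> [w|n w nN|w].
  + by rewrite chain_DE // hist0.
  + exact: chain_D_mono.
  + by rewrite /chain_D eqxx.
- split=> [A k FA|n nN A j i k FA B]; first exact: chain_initial.
  (* The kernel identity for the whole space supplies the law given the node and regime alone;
     comparing it with the one for [A] gives the cross-multiplied form. *)
  have FT : chain_F n setT by exists predT; apply/seteqP; split.
  rewrite chain_markov //.
  have := chain_markov n setT j i k nN FT; rewrite !setTI => ->.
  by rewrite -/B mulrCA mulrA.
- exact: chain_switch.
Qed.

(** * Exercise at the regime switch *)

Lemma chain_switches w : exists n, chain_D n w == 2.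
Proof. by exists N; rewrite /chain_D eqxx. Qed.

Definition chain_tau w := ex_minn (chain_switches w).

Lemma chain_tauE n w : (n < N)%N ->
  chain_tau w = n.+1 <-> chain_D n.+1 w = 2 /\ chain_D n w = 1%N.
Proof.
move=> nN; rewrite /chain_tau; case: ex_minnP => m /eqP Dm mmin.
split=> [mn|[D2 D1]].
  split; first by rewrite -mn.
  case: (chain_D_12 n w) => // Dn.
  by have := mmin n; rewrite Dn eqxx mn ltnn => /(_ isT).
have mle : (m <= n.+1)%N by apply: mmin; rewrite D2.
apply/eqP; rewrite eqn_leq mle /= ltnNge; apply/negP => mn.
have : forall k, (m <= k <= n)%N -> chain_D k w = 2.
  elim=> [|k IH] mk.
    by move: mk Dm; rewrite leqn0 => /andP[/eqP ->].
  move: mk; rewrite leq_eqVlt => /andP[/predU1P[<- //|mk kn]].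
  have := chain_D_mono k w; rewrite IH //; last lia.
  by case: (chain_D_12 k.+1 w) => -> //; move=> h2; have := h2 _; lia.
by move=> /(_ n); rewrite D1 mn leqnn => /(_ isT).
Qed.

Lemma chain_stopping_time : is_stopping_time N chain_F chain_tau.
Proof.
split=> [w|[//|n] nN].
  rewrite /chain_tau; case: ex_minnP => m Dm mmin.
  rewrite mmin ?andbT; last by rewrite /chain_D eqxx.
  by case: m Dm {mmin} => //; rewrite chain_DE // hist0.
have [sF [_ Fm]] := chain_filtration.
rewrite (_ : [set _ | _] = ev chain_D n.+1 2 `&` ev chain_D n 1).
  apply: (sigma_algebra_setI (sF n.+1 _)) => //; first exact: chain_D_adapted.
  by apply: (Fm n); [lia|exact: chain_D_adapted].
by apply/seteqP; split => w /chain_tauE; exact.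
Qed.

(** Before [N] the mass switching at a node is the increase of the regime 2 flow there; at [N] it is
    all the mass still arriving in regime 1. Both dominate [f] by (e). *)
Lemma chain_switch_mass n j : (1 <= n <= N)%N -> (j <= J)%N ->
  f j n <= Pr P ([set w | chain_tau w = n] `&` ev chain_X n j).
Proof.
have [_ fa fb _ fe] := feas.
case: n => // n nN jJ; have nltN : (n < N)%N by lia.
have [fe1 fen feN] := fe j jJ.
have [n1N|n1N] := eqVneq n.+1 N.
  rewrite (_ : [set _ | _] = [set w | (fun l => ~~ switched l) (hist n w)]).
    rewrite (Pr_hist_next n (fun l => ~~ switched l)) //.
    have [n0|n0] := posnP n.
      by rewrite n0 expect0 mul1r /= p1E; move: feN; rewrite -n1N n0 /= addr0.
    rewrite (expect_next n (fun b => (~~ b)%:R)) //; last lia.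
    rewrite big_bool /= mul0r add0r mul1r.
    have nN2 : (2 <= n.+1 <= N)%N by lia.
    have := fb j n.+1 jJ nN2; rewrite big_split /=.
    by move: feN; rewrite -n1N /= ltnS n0; lra.
  apply/seteqP; split => w /=; rewrite chain_tauE // (chain_DE n) //.
    by move=> [_]; case: switched.
  by move=> /negPf ->; rewrite /chain_D n1N eqxx.
have nN1 : (n.+1 < N)%N by lia.
rewrite (_ : _ `&` _ = [set w | predT (hist n w) && ((chain_X n.+1 w == j) &&
     (switched (hist n.+1 w) && ~~ switched (hist n w)))]).
  rewrite Pr_hist_next_switch //=.
  have [n0|n0] := posnP n.
    rewrite n0 expect0 /= mul1r h_first //; last by rewrite -n0.
    by have := fe1; rewrite n0 in nN1 *; rewrite nN1 subr_le0; exact.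
  rewrite (@eq_expect n _ (fun l =>
      (~~ switched l)%:R * h n.+1 j * move l j)); last first.
    by move=> l _; rewrite mulrA.
  rewrite (expect_next n (fun b => (~~ b)%:R * h n.+1 j)) //; last lia.
  rewrite big_bool /= !mul0r add0r mul1r h_next //.
  by have := fen n.+1; rewrite ltnS n0 nN1 /= => /(_ isT); lra.
apply/seteqP; split => w; rewrite /ev /= chain_tauE // !chain_DE //.
  by move=> [[+ +] ->]; rewrite eqxx; do 2 case: switched.
by move=> /andP[/eqP -> /andP[-> /negPf ->]].
Qed.

Lemma primal_obj_le_payoff :
  (forall j n, (j <= J)%N -> (1 <= n <= N)%N -> 0 <= a (x j) (t n)) ->
  primal_obj J N t x a f <= exp_payoff P J N t x a chain_X chain_tau.
Proof.
move=> a0; apply: ler_sum_nat => n nN; apply: ler_sum => j _.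
by rewrite ler_wpM2l ?a0 ?chain_switch_mass // -ltnS.
Qed.

End Chain.

(** * The model of a primal solution *)

Section PrimalModel.
Context {R : realType} {J N : nat} {t x : nat -> R} {s0 : R}.
Context {c : nat -> nat -> R} {a : R -> R -> R}.
Context {f : nat -> nat -> R} {g : bool -> nat -> nat -> nat -> R}.
Hypothesis gd : good_data J N t x s0 c.
Hypothesis feas : primal_feasible J N x s0 c f g.
Local Notation p := (pr J x s0 c).

(** Staying put is the default at nodes without outflow and at dates out of range: it keeps the
    kernel stochastic and mean-preserving. *)
Definition kernel (dl : bool) (n j k : nat) : R :=
  let G := \sum_(i < J.+1) g dl j i n in
  if (1 <= n < N)%N && (G != 0) then g dl j k n / G else (k == j)%:R.

(** Mass reaching [x k] at [t_n] without an earlier switch; at [t_1] this is all the mass. *)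
Definition regime1_mass (n k : nat) : R :=
  if n == 1%N then p k 1 else \sum_(i < J.+1) g true i k n.-1.

Definition switch_mass (n k : nat) : R :=
  \sum_(i < J.+1) g false k i n -
  (if n == 1%N then 0 else \sum_(i < J.+1) g false i k n.-1).

Definition switch_prob (n k : nat) : R :=
  if (1 <= n < N)%N then switch_mass n k / regime1_mass n k else 0.

Lemma kernel_ge0 dl n j k : (j <= J)%N -> (k <= J)%N -> 0 <= kernel dl n j k.
Proof.
move=> jJ kJ; rewrite /kernel; case: ifP => [/andP[nN _]|_]; last exact: ler0n.
have [[_ g0] _ _ _ _] := feas.
by rewrite divr_ge0 ?g0 // sumr_ge0 // => i _; rewrite g0 // -ltnS.
Qed.

Lemma kernel_sum dl n j : (j <= J)%N -> \sum_(k < J.+1) kernel dl n j k = 1.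
Proof.
move=> jJ; rewrite /kernel.
case: (boolP ((1 <= n < N)%N && (\sum_(i < J.+1) g dl j i n != 0))) => [/andP[_ G0]|_].
  by rewrite -mulr_suml divff.
rewrite -[RHS](sum_ord_delta J (fun=> 1) j jJ).
by apply: eq_bigr => k _; rewrite mul1r.
Qed.

Lemma kernel_mean dl n j : (j <= J)%N ->
  \sum_(k < J.+1) x k * kernel dl n j k = x j.
Proof.
move=> jJ; rewrite /kernel.
case: (boolP ((1 <= n < N)%N && (\sum_(i < J.+1) g dl j i n != 0)))
  => [/andP[nN G0]|_]; last exact: sum_ord_delta.
have [_ _ _ gm _] := feas; have := gm dl j n jJ nN.
under eq_bigr do rewrite mulrBl.
rewrite sumrB -mulr_sumr => /eqP; rewrite subr_eq0 => /eqP gE.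
under eq_bigr do rewrite mulrA.
by rewrite -mulr_suml gE mulfK.
Qed.

(** When the total outflow is zero, nonnegativity makes each [g dl j k n] zero, so the default
    kernel does no harm. *)
Lemma kernel_mass dl n j k : (1 <= n < N)%N -> (j <= J)%N -> (k <= J)%N ->
  (\sum_(i < J.+1) g dl j i n) * kernel dl n j k = g dl j k n.
Proof.
move=> nN jJ kJ; rewrite /kernel nN /=.
have [[_ g0] _ _ _ _] := feas.
case: ifPn => [G0|]; first by rewrite mulrC divfK.
rewrite negbK => /eqP G0; rewrite G0 mul0r.
have /psumr_eq0P : \sum_(i < J.+1) g dl j i n = 0 by [].
move=> /(_ _ (inord k) isT); rewrite inordK // => -> //.
by move=> i _; rewrite g0 // -ltnS.
Qed.

(** The lower bound is (e) with [f >= 0]. By (a) and (b) the gap to the upper bound is the regime 1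
    outflow, hence nonnegative. *)
Lemma switch_mass_itv n k : (1 <= n < N)%N -> (k <= J)%N ->
  0 <= switch_mass n k <= regime1_mass n k.
Proof.
move=> nN kJ; have [[f0 g0] fa fb _ fe] := feas.
have [fe1 fen _] := fe k kJ.
have fk : 0 <= f k n by apply: f0; lia.
have := fa k n kJ nN; rewrite big_split /= => out.
have out_ge0 : 0 <= \sum_(i < J.+1) g true k i n.
  by apply: sumr_ge0 => i _; rewrite g0 // -ltnS.
rewrite /switch_mass /regime1_mass; case: eqP => n1.
  rewrite n1 in nN out out_ge0 fk *.
  have := fe1 (proj2 (andP nN)); lra.
have nN2 : (2 <= n <= N)%N by lia.
have := fb k n kJ nN2; rewrite big_split /= => in_.
have := fen n; rewrite (_ : (1 < n < N)%N) => [/(_ isT)|]; last lia.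
lra.
Qed.

Lemma switch_probE n k : (1 <= n < N)%N -> (k <= J)%N ->
  switch_prob n k * regime1_mass n k = switch_mass n k.
Proof.
move=> nN kJ; rewrite /switch_prob nN.
have [m0|m0] := eqVneq (regime1_mass n k) 0; last by rewrite divfK.
by have := switch_mass_itv n k nN kJ; rewrite m0 mulr0 -eq_le => /eqP.
Qed.

Lemma switch_prob_itv n k : (k <= J)%N -> 0 <= switch_prob n k <= 1.
Proof.
move=> kJ; rewrite /switch_prob; case: ifP => nN; last by rewrite lexx ler01.
have /andP[s0_ sle] := switch_mass_itv n k nN kJ.
have [->|m0] := eqVneq (regime1_mass n k) 0; first by rewrite invr0 mulr0 lexx ler01.
have mpos : 0 < regime1_mass n k by rewrite lt_neqAle eq_sym m0 (le_trans s0_).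
by rewrite divr_ge0 ?(ltW mpos) //= ler_pdivrMr // mul1r.
Qed.

Lemma primal_model :
  (forall j n, (j <= J)%N -> (1 <= n <= N)%N -> 0 <= a (x j) (t n)) ->
  exists (P : probability nat R) (F : nat -> set (set nat))
         (X D : nat -> nat -> nat) (tau : nat -> nat),
    [/\ is_model2 P J N x s0 c F X D, is_stopping_time N F tau &
        primal_obj J N t x a f <= exp_payoff P J N t x a X tau].
Proof.
move=> a0; have N_gt0 : (0 < N)%N by case: gd => -[].
have N1 : (1 <= 1 <= N)%N by [].
pose p1 k := p k 1%N.
have p1_ge0 k : (k <= J)%N -> 0 <= p1 k by move=> kJ; exact: (pr_ge0 gd).
have p1_sum : \sum_(k < J.+1) p1 k = 1 by exact: (sum_pr1 gd).
have p1_mean : \sum_(k < J.+1) x k * p1 k = s0 by exact: (mean_pr gd).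
have h_first k : (1 < N)%N -> (k <= J)%N ->
    switch_prob 1 k * p1 k = \sum_(i < J.+1) g false k i 1.
  move=> ltN kJ; have nN : (1 <= 1 < N)%N by [].
  by have := switch_probE 1 k nN kJ; rewrite /switch_mass /= subr0.
have h_next n k : (0 < n)%N -> (n.+1 < N)%N -> (k <= J)%N ->
    switch_prob n.+1 k * \sum_(i < J.+1) g true i k n =
    \sum_(i < J.+1) g false k i n.+1 - \sum_(i < J.+1) g false i k n.
  move=> n0 nN kJ; have nN1 : (1 <= n.+1 < N)%N by [].
  have := switch_probE n.+1 k nN1 kJ; rewrite /switch_mass /regime1_mass.
  by rewrite eqSS; case: n n0 {nN nN1}.
have [P PE] := @chain_probability R J N p1 kernel switch_prob
  p1_ge0 p1_sum kernel_ge0 kernel_sum switch_prob_itv.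
exists P, (@chain_F J N), (@chain_X J N), (@chain_D J N), (@chain_tau J N).
split.
- exact: (chain_model2 p1 kernel switch_prob p1_sum kernel_sum P PE N_gt0
    (fun=> erefl) p1_mean kernel_mean feas kernel_mass h_first h_next).
- exact: chain_stopping_time.
- exact: (primal_obj_le_payoff p1 kernel switch_prob p1_sum kernel_sum P PE N_gt0
    (fun=> erefl) feas kernel_mass h_first h_next a0).
Qed.

End PrimalModel.

(** * The dual program and its multipliers *)

Lemma sum_pair {R : nmodType} {A B : finType} (F : A * B -> R) :
  \sum_i F i = \sum_a \sum_b F (a, b).
Proof. by rewrite pair_bigA; apply: eq_bigr => -[]. Qed.

Lemma sum2_ord_delta {R : pzRingType} m1 m2 (F : nat -> nat -> R) n j :
  (n <= m1)%N -> (j <= m2)%N ->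
  \sum_(n' < m1.+1) \sum_(j' < m2.+1)
    F n' j' * ((n' == n :> nat) && (j' == j :> nat))%:R =
  F n j.
Proof.
move=> nm jm; rewrite -(sum_ord_delta m1 (F^~ j) n nm); apply: eq_bigr => n' _.
rewrite -(sum_ord_delta m2 (F n') j jm) mulr_suml; apply: eq_bigr => j' _.
by case: (_ == n); rewrite ?mulr1 ?mulr0.
Qed.

Lemma sum_nat_guard {R : nmodType} m (F : nat -> R) :
  \sum_(1 <= n < m.+1) F n = \sum_(n < m.+1) if (1 <= n)%N then F n else 0.
Proof.
by rewrite -big_mkcond (big_nat_widenl 1 0) // big_mkord.
Qed.

Section LinearProgram.
Context {R : realType} {J N : nat} {t x : nat -> R} {s0 : R}.
Context {c : nat -> nat -> R} {a : R -> R -> R}.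
Hypothesis gd : good_data J N t x s0 c.
Hypothesis a0 : forall j n, (j <= J)%N -> (1 <= n <= N)%N -> 0 <= a (x j) (t n).
Local Notation p := (pr J x s0 c).

(* Indices of the dual constraints. [inl (n, j, true)] is v_{j,n} >= 0,
   [inl (n, j, false)] is (i), [inr (n, j, k, true)] is (ii) and
   [inr (n, j, k, false)] is (iii); at times outside the range of a constraint
   it reads 0 >= 0. *)
Definition dual_index : finType :=
  ('I_N.+1 * 'I_J.+1 * bool + 'I_N.+1 * 'I_J.+1 * 'I_J.+1 * bool)%type.

(* The components 0, ..., 4 are e^1, e^2, v, d^1, d^2. *)
Local Notation arrays := (nat -> nat -> nat -> R^o).

Definition dual_lhs (i : dual_index) (w : arrays) : R :=
  match i with
  | inl (n, j, _) => if (1 <= n)%N then w 2 j n else 0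
  | inr (n, j, k, dl) =>
      if (1 <= n < N)%N then
        w 0%N j n + w 1%N k n.+1 + (x k - x j) * w (if dl then 3 else 4) j n +
        (if dl then 0 else w 2 k n.+1 - w 2 j n)
      else 0
  end.

Definition dual_rhs (i : dual_index) : R :=
  if i is inl (n, j, false) then
    if (1 <= n)%N then a (x j) (t n) else 0
  else 0.

(** The entries of e^1 at [N] and of e^2 at 1 occur neither here nor in the constraints; [cut] sets
    them to the prescribed 0 afterwards. *)
Definition dual_goal (w : arrays) : R :=
  \sum_(n < N.+1) \sum_(j < J.+1)
    ((if (1 <= n < N)%N then p j n * w 0%N j n + p j n.+1 * w 1%N j n.+1 else 0) +
     (if n == N :> nat then p j N * w 2 j n else 0)).

Lemma dual_lhs_linear i : linear_form (dual_lhs i).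
Proof.
have wE (u v : arrays) r k j n : (r *: u + v) k j n = r * u k j n + v k j n by [].
case: i => [[[n j] b]|[[[n j] k] dl]] r u v /=; case: ifP => _; rewrite ?mulr0 ?addr0 //.
by case: dl; rewrite !wE; ring.
Qed.

Lemma dual_goal_linear : linear_form dual_goal.
Proof.
move=> r u v; rewrite /dual_goal mulr_sumr -big_split; apply: eq_bigr => n _ /=.
rewrite mulr_sumr -big_split; apply: eq_bigr => j _ /=.
have wE k i m : (r *: u + v) k i m = r * u k i m + v k i m by [].
by case: ifP => _; case: ifP => _; rewrite ?wE ?wE ?wE; ring.
Qed.

Section Multipliers.
Variable l : dual_index -> R.

Definition mult_f j n := l (inl (inord n, inord j, false)).
Definition mult_slack j n := l (inl (inord n, inord j, true)).
Definition mult_g dl j k n := l (inr (inord n, inord j, inord k, dl)).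

Lemma sum_multipliers (w : arrays) :
  \sum_i l i * dual_lhs i w = \sum_(n < N.+1) \sum_(j < J.+1)
    ((if (1 <= n)%N then (mult_f j n + mult_slack j n) * w 2 j n else 0) +
     (if (1 <= n < N)%N then
        (\sum_(k < J.+1) (mult_g true j k n + mult_g false j k n)) * w 0%N j n +
        (\sum_(i < J.+1) (mult_g true i j n + mult_g false i j n)) * w 1%N j n.+1 +
        (\sum_(k < J.+1) (x k - x j) * mult_g true j k n) * w 3 j n +
        (\sum_(k < J.+1) (x k - x j) * mult_g false j k n) * w 4 j n +
        (\sum_(i < J.+1) mult_g false i j n) * w 2 j n.+1 -
        (\sum_(k < J.+1) mult_g false j k n) * w 2 j n
      else 0)).
Proof.
rewrite big_sumType /=.
under [RHS]eq_bigr do rewrite big_split /=.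
rewrite big_split /=; congr (_ + _).
  rewrite sum_pair sum_pair; apply: eq_bigr => n _; apply: eq_bigr => j _.
  rewrite big_bool /= /mult_f /mult_slack !inord_val.
  by case: ifP => _; ring.
rewrite sum_pair sum_pair sum_pair; apply: eq_bigr => n _.
case: (boolP (1 <= n < N)%N) => nN; last first.
  rewrite big1 => [|j _]; first by rewrite big1.
  rewrite big1 // => k _; rewrite big1 // => dl _ /=.
  by rewrite ?(negPf nN) mulr0.
pose G dl (j k : 'I_J.+1) := mult_g dl j k n.
(* Terms carried by the departure index are separated from those carried by the arrival index;
   exchanging the sums of the latter makes arrival the outer index. *)
transitivity (\sum_(j < J.+1) \sum_(k < J.+1)
   ((G true j k + G false j k) * w 0%N j n + (x k - x j) * G true j k * w 3 j n
    + (x k - x j) * G false j k * w 4 j n - G false j k * w 2 j n) +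
   \sum_(j < J.+1) \sum_(k < J.+1) ((G true j k + G false j k) * w 1%N k n.+1 +
      G false j k * w 2 k n.+1)).
  rewrite -big_split; apply: eq_bigr => j _ /=.
  rewrite -big_split; apply: eq_bigr => k _ /=.
  by rewrite big_bool /= ?nN /G /mult_g !inord_val; ring.
rewrite [X in _ + X]exchange_big -big_split; apply: eq_bigr => j _ /=.
rewrite sumrB !big_split /= -!mulr_suml !big_split /=.
ring.
Qed.

End Multipliers.

(* Read off coefficients with indicator arrays; v_{j,n} occurs at both n and n.+1. *)
Lemma array_coef (c0 c1 c2 c2' c3 c4 : nat -> nat -> R) :
  (forall w : arrays, \sum_(n < N.+1) \sum_(j < J.+1)
     (c0 n j * w 0%N j n + c1 n j * w 1%N j n.+1 + c2 n j * w 2 j n +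
      c2' n j * w 2 j n.+1 + c3 n j * w 3 j n + c4 n j * w 4 j n) = 0) ->
  forall n j, (n <= N)%N -> (j <= J)%N ->
    [/\ c0 n j = 0, c1 n j = 0, c3 n j = 0, c4 n j = 0 &
        (n < N)%N -> c2 n.+1 j + c2' n j = 0].
Proof.
move=> id n j nN jJ.
pose delta i0 n0 : arrays :=
  fun i j' n' => (i == i0)%:R * ((n' == n0) && (j' == j))%:R.
have coefE i0 n0 F : (forall n' j', c0 n' j' * delta i0 n0 0 j' n' +
      c1 n' j' * delta i0 n0 1 j' n'.+1 + c2 n' j' * delta i0 n0 2 j' n' +
      c2' n' j' * delta i0 n0 2 j' n'.+1 + c3 n' j' * delta i0 n0 3 j' n' +
      c4 n' j' * delta i0 n0 4 j' n' =
      F n' j' * ((n' == n) && (j' == j))%:R) -> F n j = 0.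
  move=> FE; rewrite -(sum2_ord_delta _ _ F _ _ nN jJ) -[RHS](id (delta i0 n0)).
  by apply: eq_bigr => n' _; apply: eq_bigr => j' _; rewrite FE.
split=> [||||ltN].
- by apply: (coefE 0 n c0) => n' j'; rewrite /delta /=; ring.
- by apply: (coefE 1 n.+1 c1) => n' j'; rewrite /delta /= eqSS; ring.
- by apply: (coefE 3 n c3) => n' j'; rewrite /delta /=; ring.
- by apply: (coefE 4 n c4) => n' j'; rewrite /delta /=; ring.
have := id (delta 2 n.+1) => idw.
rewrite -(sum2_ord_delta _ _ c2 _ _ ltN jJ) -(sum2_ord_delta _ _ c2' _ _ nN jJ).
rewrite -big_split -[RHS]idw; apply: eq_bigr => n' _ /=.
rewrite -big_split; apply: eq_bigr => j' _ /=.
by rewrite /delta /= eqSS; ring.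
Qed.

Lemma multiplier_feasible l : lp_multiplier dual_lhs dual_goal l ->
  primal_feasible J N x s0 c (mult_f l) (mult_g l).
Proof.
move=> ml; set f := mult_f l; set g := mult_g l.
pose s := mult_slack l.
pose G n r : R := if (1 <= n < N)%N then r else 0.
pose k0 n j := G n (\sum_(k < J.+1) (g true j k n + g false j k n) - p j n).
pose k1 n j := G n (\sum_(i < J.+1) (g true i j n + g false i j n) - p j n.+1).
pose k2 n j := (if (1 <= n)%N then f j n + s j n else 0) -
  G n (\sum_(k < J.+1) g false j k n) - (if n == N then p j N else 0).
pose k2' n j := G n (\sum_(i < J.+1) g false i j n).
pose k3 n j := G n (\sum_(k < J.+1) (x k - x j) * g true j k n).
pose k4 n j := G n (\sum_(k < J.+1) (x k - x j) * g false j k n).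
have id (w : arrays) : \sum_(n < N.+1) \sum_(j < J.+1)
     (k0 n j * w 0%N j n + k1 n j * w 1%N j n.+1 + k2 n j * w 2 j n +
      k2' n j * w 2 j n.+1 + k3 n j * w 3 j n + k4 n j * w 4 j n) = 0.
  rewrite -[RHS](subrr (dual_goal w)) {1}(ml.2 w) sum_multipliers /dual_goal.
  rewrite -sumrB; apply: eq_bigr => n _; rewrite -sumrB; apply: eq_bigr => j _.
  rewrite /k0 /k1 /k2 /k2' /k3 /k4 /G /s /g /f.
  by case: ifP => _; case: ifP => _; case: ifP => _; ring.
have coefs := array_coef k0 k1 k2 k2' k3 k4 id.
have [f0 [s0_ g0]] : (forall j n, 0 <= f j n) /\ (forall j n, 0 <= s j n) /\
    forall dl j k n, 0 <= g dl j k n.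
  by have [l0 _] := ml; split=> [j n|]; [|split=> *]; exact: l0.
have GE n r : (1 <= n < N)%N -> G n r = r by rewrite /G => ->.
split.
- by split=> *; [exact: f0|exact: g0].
- move=> j n jJ nN; have nN' : (n <= N)%N by lia.
  by have [+ _ _ _ _] := coefs n j nN' jJ; rewrite /k0 /k1 GE // => /subr0_eq.
- move=> j [//|n] jJ nN; have nN' : (n <= N)%N by lia.
  by have [_ + _ _ _] := coefs n j nN' jJ; rewrite /k0 /k1 GE // => /subr0_eq.
- move=> dl j n jJ nN; have nN' : (n <= N)%N by lia.
  by have [_ _ + + _] := coefs n j nN' jJ; rewrite /k3 /k4 !GE //; case: dl.
(* This is the coefficient of v_{j,n+1} with the nonnegative slack dropped. The guard [G] covers all
   three cases of (e): no inflow at date 1, no outflow at date [N]. *)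
have main n j : (n < N)%N -> (j <= J)%N ->
    f j n.+1 - G n.+1 (\sum_(k < J.+1) g false j k n.+1) +
    G n (\sum_(i < J.+1) g false i j n) <= (if n.+1 == N then p j N else 0).
  move=> nN jJ; have [_ _ _ _ /(_ nN)] := coefs n j (ltnW nN) jJ.
  by have := s0_ j n.+1; rewrite /k2 /k2' /=; lra.
move=> j jJ; split=> [ltN|[//|n] nN|].
- have := main 0%N j (ltnW ltN) jJ; rewrite ifF; last by case: N ltN => [|[]].
  by rewrite GE // /G /= addr0.
- have := main n j _ jJ; rewrite ifF; last by apply/eqP; lia.
  by rewrite !GE; try lia; apply; lia.
- have N0 : (0 < N)%N by case: gd => -[].
  have lN : (N.-1 < N)%N by rewrite prednK.
  have := main N.-1 j lN jJ; rewrite /G lN andbT prednK // eqxx ltnn andbF subr0.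
  by rewrite (_ : (1 < N)%N = (0 < N.-1)%N) //; lia.
Qed.

Lemma multiplier_obj l :
  \sum_i l i * dual_rhs i = primal_obj J N t x a (mult_f l).
Proof.
rewrite big_sumType /= [X in _ + X]big1 ?addr0 => [|i _]; last by rewrite mulr0.
rewrite /primal_obj sum_nat_guard sum_pair sum_pair; apply: eq_bigr => n _ /=.
case: ifP => n0; last first.
  rewrite big1 // => j _; rewrite big_bool /= ?n0 !mulr0 addr0 //.
apply: eq_bigr => j _; rewrite big_bool /= ?n0 mulr0 add0r.
by rewrite /mult_f !inord_val mulrC.
Qed.

Definition cut (e : nat -> nat -> R) (n0 j n : nat) : R :=
  if n == n0 then 0 else e j n.

Lemma lp_feasible_dual (w : arrays) : lp_feasible dual_lhs dual_rhs w ->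
  dual_feasible J N t x a (cut (w 0%N) N) (cut (w 1%N) 1) (w 2) (w 3) (w 4).
Proof.
move=> fw.
have fr dl j k n : (j <= J)%N -> (k <= J)%N -> (1 <= n < N)%N ->
    0 <= w 0%N j n + w 1%N k n.+1 + (x k - x j) * w (if dl then 3 else 4) j n +
        (if dl then 0 else w 2 k n.+1 - w 2 j n).
  move=> jJ kJ nN; have := fw (inr (inord n, inord j, inord k, dl)).
  by rewrite /= !inordK ?nN //; lia.
have fl b j n : (j <= J)%N -> (1 <= n <= N)%N ->
    (if b then 0 else a (x j) (t n)) <= w 2 j n.
  move=> jJ nN; have := fw (inl (inord n, inord j, b)).
  rewrite /= !inordK //; try lia.
  by rewrite (_ : (1 <= n)%N); [case: b|lia].
have cutE j n k : (1 <= n < N)%N ->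
    cut (w 0%N) N j n = w 0%N j n /\ cut (w 1%N) 1 k n.+1 = w 1%N k n.+1.
  by move=> nN; rewrite /cut !ifF //; apply/eqP; lia.
split.
- by move=> j jJ; rewrite /cut !eqxx.
- by move=> j n jJ nN; exact: (fl true).
- by move=> j n jJ nN; exact: (fl false).
- move=> j k n jJ kJ nN; have [-> ->] := cutE j n k nN.
  by have := fr true j k n jJ kJ nN; rewrite addr0.
- move=> j k n jJ kJ nN; have [-> ->] := cutE j n k nN.
  by have := fr false j k n jJ kJ nN => /=; lra.
Qed.

Lemma dual_goal_obj (w : arrays) :
  dual_goal w = dual_obj J N x s0 c (cut (w 0%N) N) (cut (w 1%N) 1) (w 2).
Proof.
have N0 : (0 < N)%N by case: gd => -[].
rewrite /dual_goal /dual_obj exchange_big -big_split; apply: eq_bigr => j _ /=.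
rewrite big_split /=; congr (_ + _); last first.
  rewrite -[RHS](sum_ord_delta N (fun=> w 2 j N * p j N) N) //.
  by apply: eq_bigr => n _; case: eqP => [->|_] /=; ring.
under [RHS]eq_bigr do rewrite mulrDl.
have e1E : \sum_(1 <= n < N.+1) cut (w 0%N) N j n * p j n =
    \sum_(1 <= n < N) w 0%N j n * p j n.
  rewrite big_nat_recr //= /cut eqxx mul0r addr0; apply: eq_big_nat => n nN.
  by rewrite ifF //; apply/eqP; lia.
have e2E : \sum_(1 <= n < N.+1) cut (w 1%N) 1 j n * p j n =
    \sum_(1 <= n < N) w 1%N j n.+1 * p j n.+1.
  rewrite big_ltn // /cut eqxx mul0r add0r big_add1 /=; apply: eq_big_nat => n nN.
  by rewrite ifF //; apply/eqP; lia.
rewrite big_split /= e1E e2E -big_split /=.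
transitivity (\sum_(1 <= n < N.+1) if (n < N)%N then
    p j n * w 0%N j n + p j n.+1 * w 1%N j n.+1 else 0).
  rewrite sum_nat_guard; apply: eq_bigr => n _.
  by case: ifP => [/andP[-> ->]//|]; case: (1 <= n)%N => //= ->.
rewrite big_nat_recr //= ltnn addr0; apply: eq_big_nat => n nN.
by have [_ ->] := andP nN; ring.
Qed.


(** Take [v] constant and above every payoff (their sum will do, as [a >= 0]) and all other
    variables zero. *)
Lemma lp_feasible_nonempty : exists w, lp_feasible dual_lhs dual_rhs w.
Proof.
pose A n j : R := if (1 <= n <= N)%N && (j <= J)%N then a (x j) (t n) else 0.
have A0 n j : 0 <= A n j.
  by rewrite /A; case: ifP => // /andP[nN jJ]; exact: a0.
pose M := \sum_(n < N.+1) \sum_(j < J.+1) A n j.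
have AM n j : (n <= N)%N -> (j <= J)%N -> A n j <= M.
  move=> nN jJ; rewrite -(sum2_ord_delta _ _ A _ _ nN jJ).
  apply: ler_sum => n' _; apply: ler_sum => j' _.
  by case: (_ && _); rewrite ?mulr1 ?mulr0.
have M0 : 0 <= M by apply: sumr_ge0 => n _; apply: sumr_ge0.
exists (fun i _ _ => if i == 2 then M else 0).
move=> [[[n j] b]|[[[n j] k] dl]] /=; last first.
  by case: ifP => // _; case: dl => /=; rewrite ?subrr !(mulr0, addr0).
case: b; first by case: ifP.
case: ifP => // n1.
have nN : (n <= N)%N by rewrite -ltnS.
have jJ : (j <= J)%N by rewrite -ltnS.
by have := AM n j nN jJ; rewrite /A n1 nN jJ.
Qed.

(** The primal point without exercise: the martingale couplings serve as g^1, [f] and g^2 vanish,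
    and the slack at [N] absorbs [p j N]. *)
Lemma lp_multiplier_nonempty : exists l, lp_multiplier dual_lhs dual_goal l.
Proof.
have : forall n, exists g : nat -> nat -> R, (1 <= n < N)%N ->
  [/\ forall j k, 0 <= g j k,
      forall j, (j <= J)%N -> \sum_(k < J.+1) g j k = p j n,
      forall k, (k <= J)%N -> \sum_(j < J.+1) g j k = p k n.+1 &
      forall j, (j <= J)%N -> \sum_(k < J.+1) (x k - x j) * g j k = 0].
  move=> n; have [nN|nN] := boolP (1 <= n < N)%N; last by exists (fun _ _ => 0).
  by have [g gE] := martingale_coupling gd n nN; exists g.
move=> /choice[g gE].
pose l (i : dual_index) : R :=
  match i with
  | inl (n, j, b) => if b && (n == N :> nat) then p j N else 0
  | inr (n, j, k, dl) => if dl && (1 <= n < N)%N then g n j k else 0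
  end.
have N0 : (0 < N)%N by case: gd => -[].
exists l; split.
  move=> [[[n j] b]|[[[n j] k] dl]] /=; case: ifP => // /andP[_].
    by move=> _; apply: (pr_ge0 gd); [rewrite -ltnS|rewrite N0 leqnn].
  by move=> /gE[].
move=> w; rewrite sum_multipliers; apply: eq_bigr => n _; apply: eq_bigr => j _.
have jJ : (j <= J)%N by rewrite -ltnS.
have nN : (n <= N)%N by rewrite -ltnS.
rewrite /mult_f /mult_slack /= !inord_val /= add0r [LHS]addrC; congr (_ + _).
  by case: eqP => [->|_]; [rewrite N0|case: ifP; rewrite // mul0r].
case: ifP => // nltN; have [g0 gout gin gmart] := gE n nltN.
have g1E (u v : 'I_J.+1) : mult_g l true u v n = g n u v.
  by rewrite /mult_g /= !inord_val nltN.
have g2E (u v : 'I_J.+1) : mult_g l false u v n = 0 by [].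
have E0 : \sum_(k < J.+1) (mult_g l true j k n + mult_g l false j k n) = p j n.
  by rewrite -gout //; apply: eq_bigr => k _; rewrite g1E g2E addr0.
have E1 : \sum_(i < J.+1) (mult_g l true i j n + mult_g l false i j n) = p j n.+1.
  by rewrite -gin //; apply: eq_bigr => i _; rewrite g1E g2E addr0.
have E3 : \sum_(k < J.+1) (x k - x j) * mult_g l true j k n = 0.
  by rewrite -[RHS](gmart j jJ); apply: eq_bigr => k _; rewrite g1E.
have E4 : \sum_(k < J.+1) (x k - x j) * mult_g l false j k n = 0.
  by rewrite big1 // => k _; rewrite g2E mulr0.
have E5 : \sum_(i < J.+1) mult_g l false i j n = 0 by rewrite big1.
have E6 : \sum_(k < J.+1) mult_g l false j k n = 0 by rewrite big1.
by rewrite E0 E1 E3 E4 E5 ?E6 !mul0r !addr0 subr0.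
Qed.

Lemma lp_optimal : exists w l,
  [/\ lp_feasible dual_lhs dual_rhs w, lp_multiplier dual_lhs dual_goal l &
      dual_goal w = \sum_i l i * dual_rhs i].
Proof.
have [w fw] := lp_feasible_nonempty; have [l ml] := lp_multiplier_nonempty.
exact: (lp_strong_duality _ _ _ dual_lhs_linear dual_goal_linear _ _ fw ml).
Qed.

End LinearProgram.

(** * Markovian strategies and the main theorem *)

Section MarkovStrategy.
Context {R : realType} {J N : nat} {t x : nat -> R} {s0 : R}.
Context {c : nat -> nat -> R} {a : R -> R -> R}.
Context {e1 e2 v d1 d2 : nat -> nat -> R}.

Lemma markov_nonanticipative :
  nonanticipative N (markov_Th1 d1) (markov_Th2 d2).
Proof.
move=> n /andP[n1 _] u w uw.
by rewrite /markov_Th1 /markov_Th2 (uw n) // n1 leqnn.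
Qed.

Lemma markov_cost :
  (0 < N)%N ->
  cost J N x s0 c (markov_b N e1 e2 v) = dual_obj J N x s0 c e1 e2 v.
Proof.
move=> N0.
rewrite /cost /dual_obj exchange_big -big_split; apply: eq_bigr => j _ /=.
rewrite big_nat_recr //= [in RHS]big_nat_recr //= -addrA; congr (_ + _).
  by apply: eq_big_nat => n nN; rewrite /markov_b ifF //; apply/eqP; lia.
by rewrite /markov_b eqxx; ring.
Qed.

Lemma markov_superreplicates : dual_feasible J N t x a e1 e2 v d1 d2 ->
  superreplicates J N t x a (markov_b N e1 e2 v) (markov_Th1 d1) (markov_Th2 d2).
Proof.
move=> [e0 _ va c1 c2] u uJ r rN.
have N0 : (0 < N)%N by lia.
have [r1 rle] := andP rN.
apply: le_trans (va _ _ (uJ r rN) rN) _.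
rewrite /gain.
(* Here [e2] is shifted by one date to pair with [e1] as in (ii) and (iii); the terms lost, [e1] at
   [N] and [e2] at 1, are zero. *)
have -> : \sum_(1 <= n < N.+1) \sum_(j < J.+1) markov_b N e1 e2 v j n * (u n == j)%:R
    = \sum_(1 <= n < N) (e1 (u n) n + e2 (u n.+1) n.+1) + v (u N) N.
  transitivity (\sum_(1 <= n < N.+1) markov_b N e1 e2 v (u n) n).
    apply: eq_big_nat => n nN.
    rewrite -(sum_ord_delta J (markov_b N e1 e2 v ^~ n) (u n)) ?uJ //.
    by apply: eq_bigr => j _; rewrite eq_sym.
  transitivity (\sum_(1 <= n < N.+1) e1 (u n) n + \sum_(1 <= n < N.+1) e2 (u n) n
      + v (u N) N).
    rewrite big_nat_recr // [in RHS]big_nat_recr // [X in _ + X + _]big_nat_recr //=.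
    rewrite /markov_b eqxx.
    rewrite (@eq_big_nat _ _ _ 1 N _ (fun n => e1 (u n) n + e2 (u n) n)); last first.
      by move=> n nN; rewrite ifF //; apply/eqP; lia.
    by rewrite big_split /=; ring.
  rewrite big_split /=; congr (_ + _ + _).
    by rewrite big_nat_recr //= (e0 _ (uJ N _)).1 ?addr0 // N0 leqnn.
  by rewrite big_ltn // (e0 _ (uJ 1%N _)).2 ?add0r ?big_add1.
rewrite (@big_cat_nat _ _ _ r) //=.
have before : 0 <= \sum_(1 <= n < r) (e1 (u n) n + e2 (u n.+1) n.+1) +
    \sum_(1 <= n < r) markov_Th1 d1 n u * (x (u n.+1) - x (u n)).
  rewrite -big_split big_nat; apply: sumr_ge0 => n nr /=.
  have := c1 (u n) (u n.+1) n; rewrite /markov_Th1 mulrC.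
  by apply; [apply: uJ; lia|apply: uJ; lia|lia].
have after : v (u r) r - v (u N) N <=
    \sum_(r <= n < N) (e1 (u n) n + e2 (u n.+1) n.+1) +
    \sum_(r <= n < N) markov_Th2 d2 n u r * (x (u n.+1) - x (u n)).
  rewrite -[leLHS]opprB -(telescope_sumr (fun n => v (u n) n) rle) -sumrN -big_split.
  apply: ler_sum_nat => n nr /=.
  have := c2 (u n) (u n.+1) n; rewrite /markov_Th2.
  move=> /(_ _ _ _) h; have := h (uJ _ _) (uJ _ _) _.
  by move=> /(_ ltac:(lia) ltac:(lia) ltac:(lia)); lra.
by lra.
Qed.

End MarkovStrategy.

Lemma sup_maximum {R : realType} (S : set R) m : S m -> ubound S m -> sup S = m.
Proof.
move=> Sm ub; apply/le_anti; rewrite ge_sup //=; last by exists m.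
by apply: sup_upper_bound => //; split; exists m.
Qed.

Lemma inf_minimum {R : realType} (S : set R) m : S m -> lbound S m -> inf S = m.
Proof.
move=> Sm lb; apply/le_anti; rewrite lb_le_inf ?andbT //; last by exists m.
by apply: ge_inf => //; exists m.
Qed.

Lemma model_price_le {R : realType} {J N : nat} {t x : nat -> R} {s0 : R}
    {c : nat -> nat -> R} {a : R -> R -> R} {d : measure_display}
    {T : measurableType d} {P : probability T R} {F : nat -> set (set T)}
    {X : nat -> T -> nat} {b : nat -> nat -> R} {Th1 Th2} :
  (0 < N)%N -> is_model P J N x s0 c F X ->
  nonanticipative N Th1 Th2 -> superreplicates J N t x a b Th1 Th2 ->
  model_price P J N t x a F X <= cost J N x s0 c b.
Proof.
move=> N0 mod na sr; apply: ge_sup; last first.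
  by move=> _ [tau st <-]; exact: (exp_payoff_le_cost mod st b _ _ na sr).
(* The set of payoffs is nonempty because exercise at [t_1] is a stopping time. *)
exists (exp_payoff P J N t x a X (fun=> 1%N)); exists (fun=> 1%N) => //.
split=> [w|n nN]; first by rewrite N0.
have sF := filtration_sigma mod n _.
have := sigma_algebra_cst (sF _) (1 == n)%N; case/andP: nN => _ nN /(_ nN).
by congr (F n); apply/seteqP; split => w /= /eqP.
Qed.

Theorem mainTheorem1 (R : realType) (J N : nat) (t x : nat -> R) (s0 : R)
    (c : nat -> nat -> R) (a : R -> R -> R) :
  good_data J N t x s0 c ->
  (forall j n, (j <= J)%N -> (1 <= n <= N)%N -> 0 <= a (x j) (t n)) ->
  [/\ primal_value J N t x s0 c a = model_sup J N t x s0 c a,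
      model_sup J N t x s0 c a = hedge_inf J N t x s0 c a,
      hedge_inf J N t x s0 c a = dual_value J N t x s0 c a,
      (exists (d : measure_display) (T : measurableType d)
              (P : probability T R) (F : nat -> set (set T))
              (X D : nat -> T -> nat),
          is_model2 P J N x s0 c F X D /\
          model_price P J N t x a F X = model_sup J N t x s0 c a) &
      (exists e1 e2 v d1 d2 : nat -> nat -> R,
          nonanticipative N (markov_Th1 d1) (markov_Th2 d2) /\
          superreplicates J N t x a (markov_b N e1 e2 v)
            (markov_Th1 d1) (markov_Th2 d2) /\
          cost J N x s0 c (markov_b N e1 e2 v) = hedge_inf J N t x s0 c a)].
Proof.
move=> gd a0; have N0 : (0 < N)%N by case: gd => -[].

have [w [l [fw ml wl]]] := lp_optimal gd a0.
(* Every value in the statement is identified with this common optimum. *)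
pose V := dual_goal (s0 := s0) (c := c) (J := J) (N := N) (x := x) w.
have pf := multiplier_feasible gd l ml.
have objV : primal_obj J N t x a (mult_f l) = V by rewrite -multiplier_obj -wl.
have df := lp_feasible_dual w fw.
have dobjV : V = dual_obj J N x s0 c (cut (w 0%N) N) (cut (w 1%N) 1) (w 2).
  exact: (dual_goal_obj gd w).
have [P [F [X [D [tau [m2 st payV]]]]]] := primal_model gd pf a0.
have mod : is_model P J N x s0 c F X by case: m2.
have na : nonanticipative N (markov_Th1 (w 3)) (markov_Th2 (w 4)).
  exact: markov_nonanticipative.
have sr := markov_superreplicates df.
have costV := markov_cost (J := J) (x := x) (s0 := s0) (c := c) (e1 := cut (w 0%N) N)
  (e2 := cut (w 1%N) 1) (v := w 2) N0.
rewrite -dobjV in costV.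
have price_le (d : measure_display) (T : measurableType d) (P' : probability T R)
    F' X' : is_model P' J N x s0 c F' X' -> model_price P' J N t x a F' X' <= V.
  by move=> mod'; rewrite -costV; exact: model_price_le N0 mod' na sr.
have cost_ge b Th1 Th2 : nonanticipative N Th1 Th2 ->
    superreplicates J N t x a b Th1 Th2 -> V <= cost J N x s0 c b.
  move=> na' sr'; rewrite -objV; apply: (le_trans payV).
  exact: (exp_payoff_le_cost mod st b _ _ na' sr').
have obj_le f g : primal_feasible J N x s0 c f g -> primal_obj J N t x a f <= V.
  move=> pf'; have [P' [F' [X' [D' [tau' [m2' st' pay']]]]]] := primal_model gd pf' a0.
  rewrite -costV; apply: (le_trans pay').
  have mod' : is_model P' J N x s0 c F' X' by case: m2'.
  exact: (exp_payoff_le_cost mod' st' _ _ _ na sr).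
(* Exercise at the switch already earns [V], and no stopping time beats the cost of the optimal
   Markovian hedge. *)
have priceV : model_price P J N t x a F X = V.
  apply/le_anti; rewrite price_le //= -objV; apply: (le_trans payV).
  apply: sup_upper_bound; last by exists tau.
  split; first by exists (exp_payoff P J N t x a X tau); exists tau.
  exists V => _ [tau' st' <-]; rewrite -costV.
  exact: (exp_payoff_le_cost mod st' _ _ _ na sr).
have -> : primal_value J N t x s0 c a = V.
  apply: sup_maximum; first by exists (mult_f l) => //; exists (mult_g l).
  by move=> _ [f [g fg] <-]; exact: obj_le fg.
have supV : model_sup J N t x s0 c a = V.
  apply: sup_maximum; first by exists _, _, P, F, X.
  by move=> _ [d [T [P' [F' [X' [mod' ->]]]]]]; exact: price_le.
have infV : hedge_inf J N t x s0 c a = V.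
  apply: inf_minimum.
    exists (markov_b N (cut (w 0%N) N) (cut (w 1%N) 1) (w 2)) => //.
    by eexists; eexists; split; [exact: na|exact: sr].
  by move=> _ [b [Th1 [Th2 [na' sr']]] <-]; exact: cost_ge na' sr'.
have dualV : dual_value J N t x s0 c a = V.
  apply: inf_minimum.
    by exists (cut (w 0%N) N), (cut (w 1%N) 1), (w 2), (w 3), (w 4).
  move=> _ [e1 [e2 [v [d1 [d2 [df' ->]]]]]].
  rewrite -markov_cost //.
  apply: (cost_ge _ _ _ (markov_nonanticipative (d1 := d1) (d2 := d2))).
  exact: markov_superreplicates df'.
rewrite supV infV dualV; split => //.
- by exists _, _, P, F, X, D.
- by exists (cut (w 0%N) N), (cut (w 1%N) 1), (w 2), (w 3), (w 4); split; [|split].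
Qed.
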